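(* Let $q\in(0,1)$. Let $m_i:\mathrm{Pol}(\mathbb C)_q\times\mathrm{Pol}(\mathbb C)_q\to\mathrm{Pol}(\mathbb C)_q$, $i\ge 1$, be the bilinear maps of the Berezin deformation $\star_B$, so that $f\star_B g=f\cdot g+t\,m_1(f,g)+t^2m_2(f,g)+\dots$ for $f,g\in \mathrm{Pol}(\mathbb C)_q$. Then any real covariant deformation with separation of variables $\star_t$ of the algebra $\mathrm{Pol}(\mathbb C)_q$ can be obtained from the Berezin deformation via change of formal parameter: there exists a formal series $c(t)\in\mathbb C[[t]]$ with $c(0)=0$ such that for all $f,g\in\mathrm{Pol}(\mathbb C)_q$ $$f\star_t g=f\cdot g+c(t)\,m_1(f,g)+c(t)^2\,m_2(f,g)+\dots .$$
   Context: Ground field $\mathbb C$, $q\in(0,1)$. $\mathrm{Pol}(\mathbb C)_q$ is the unital involutive algebra with one generator $z$ and the relation $z^*z=q^2zz^*+1-q^2$. Let $\mathbb C[z]_q,\mathbb C[z^*]_q$ be the unital subalgebras generated by $z$ and by $z^*$. The monomials $z^iz^{*j}$ form a basis of $\mathrm{Pol}(\mathbb C)_q$. $U_q\mathfrak{sl}_2$ is the Hopf algebra with generators $K^{\pm1},E,F$ and relations $KK^{-1}=K^{-1}K=1$, $K^{\pm1}E=q^{\pm2}EK^{\pm1}$, $K^{\pm1}F=q^{\mp2}FK^{\pm1}$, $EF-FE=(K-K^{-1})/(q-q^{-1})$, $\Delta(K^{\pm1})=K^{\pm1}\otimes K^{\pm1}$, $\Delta(E)=E\otimes1+K\otimes E$,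 $\Delta(F)=F\otimes K^{-1}+1\otimes F$, $\varepsilon(E)=\varepsilon(F)=\varepsilon(K^{\pm1}-1)=0$, $S(K^{\pm1})=K^{\mp1}$, $S(E)=-K^{-1}E$, $S(F)=-FK$. With the involution $E^*=-KF$, $F^*=-EK^{-1}$, $(K^{\pm1})^*=K^{\pm1}$ it is the $*$-Hopf algebra $U_q\mathfrak{su}_{1,1}$. A unital algebra $\mathcal F$ which is a $U_q\mathfrak{sl}_2$-module is a $U_q\mathfrak{sl}_2$-module algebra if the multiplication $\mathcal F\otimes\mathcal F\to\mathcal F$ is a module morphism and $\xi(1)=\varepsilon(\xi)1$; an involutive algebra is a $U_q\mathfrak{su}_{1,1}$-module algebra if moreover $(\xi f)^*=(S(\xi))^*f^*$. There is a unique structure of $U_q\mathfrak{su}_{1,1}$-module algebra in $\mathrm{Pol}(\mathbb C)_q$ with $K^{\pm1}z=q^{\pm2}z$, $Ez=-q^{1/2}z^2$, $Fz=q^{1/2}$. It is extended $\mathbb C[[t]]$-linearly and $t$-adically continuously to $\mathrm{Pol}(\mathbb C)_q[[t]]$. A deformation of $\mathrm{Pol}(\mathbb C)_q$ is an associative $\mathbb C[[t]]$-bilinear, $t$-adically continuous product $\star_t$ on $\mathrm{Pol}(\mathbb C)_q[[t]]$ given for $f,g\in\mathrm{Pol}(\mathbb C)_q$ by $f\star_tg=f\cdot g+t\,m_1(f,g)+t^2m_2(f,g)+\dots$, with $m_i:\mathrm{Pol}(\mathbb C)_q\times\mathrm{Pol}(\mathbb C)_q\to\mathrm{Pol}(\mathbb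 C)_q$ bilinear. It is - *with separation of variables* if $f\star_t g=f\cdot g$ whenever $f\in\mathbb C[z]_q$ or $g\in\mathbb C[z^*]_q$; - *real* if $(f\star_t g)^*=g^*\star_t f^*$ for all $f,g\in\mathrm{Pol}(\mathbb C)_q$ (with $t^*=t$); - *covariant* if $\mathrm{Pol}(\mathbb C)_q[[t]]$ with product $\star_t$ is a $U_q\mathfrak{sl}_2$-module algebra. *The Berezin deformation $\star_B$.* Let $\mathcal P$ be the unital involutive $\mathbb C[[t]]$-algebra with generator $z$ and relation $$z^*z=q^2zz^*+1-q^2+\frac{(1-q^2)t}{1-q^2t}(1-z^*z)(1-zz^* ),$$ and let $P=\mathrm{Pol}(\mathbb C)_q\otimes\mathbb C[[t]]$. For each $n$ the $\mathbb C[[t]]$-linear map $P/t^nP\to\mathcal P/t^n\mathcal P$, $z^iz^{*j}\mapsto z^iz^{*j}$, is an isomorphism of $\mathbb C[[t]]$-modules; let $I_\infty:\overline P\to\overline{\mathcal P}$ be the induced isomorphism of $t$-adic completions, $\overline P\simeq\mathrm{Pol}(\mathbb C)_q[[t]]$. Then $f\star_B g=I_\infty^{-1}(I_\infty(f)\cdot I_\infty(g))$; this is a real covariant deformation with separation of variables. *)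

(* Defs.v *)
From HB Require Import structures.
From mathcomp Require Import all_boot all_order all_algebra.
From mathcomp Require Import boolp reals.
From mathcomp.real_closed Require Import complex.
Set Implicit Arguments.
Unset Strict Implicit.
Unset Printing Implicit Defensive.
Import GRing.Theory.
Local Open Scope ring_scope.
Local Open Scope quotient_scope.
Local Open Scope complex_scope.

Record tser (V : Type) := TSer { tcoef : nat -> V }.

Lemma tserP (V : Type) (F G : tser V) :
  (forall n, tcoef F n = tcoef G n) -> F = G.
Proof.
by case: F G => f [g] /= fg; congr TSer; apply: funext.
Qed.

HB.instance Definition _ (V : Type) := gen_eqMixin (tser V).
HB.instance Definition _ (V : Type) := gen_choiceMixin (tser V).

Section TserZmod.
Variable V : zmodType.
Implicit Types F G H : tser V.

Definition tadd F G : tser V := TSer (fun n => tcoef F n + tcoef G n).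
Definition topp F : tser V := TSer (fun n => - tcoef F n).
Definition tzero : tser V := TSer (fun=> 0).

Lemma taddA : associative tadd.
Proof. by move=> F G H; apply: tserP => n /=; rewrite addrA. Qed.
Lemma taddC : commutative tadd.
Proof. by move=> F G; apply: tserP => n /=; rewrite addrC. Qed.
Lemma tadd0 : left_id tzero tadd.
Proof. by move=> F; apply: tserP => n /=; rewrite add0r. Qed.
Lemma taddN : left_inverse tzero topp tadd.
Proof. by move=> F; apply: tserP => n /=; rewrite addNr. Qed.

HB.instance Definition _ :=
  GRing.isZmodule.Build (tser V) taddA taddC tadd0 taddN.

Definition tconst (v : V) : tser V := TSer (fun n => if n is 0%N then v else 0).

Definition teqmod (n : nat) F G := forall k, (k < n)%N -> tcoef F k = tcoef G k.

Definition tadic_limit (u : nat -> tser V) F :=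
  forall n, exists N0, forall N, (N0 <= N)%N -> teqmod n (u N) F.

Definition tadic_continuous2 (m : tser V -> tser V -> tser V) :=
  forall F G n, exists N, forall F' G',
    teqmod N F F' -> teqmod N G G' -> teqmod n (m F G) (m F' G').
End TserZmod.

Section TserLmod.
Variables (k : pzRingType) (V : lmodType k).

Definition tscal (a : k) (F : tser V) : tser V := TSer (fun n => a *: tcoef F n).

Lemma tscalA a b F : tscal a (tscal b F) = tscal (a * b) F.
Proof. by apply: tserP => n /=; rewrite scalerA. Qed.
Lemma tscal1 : left_id 1 tscal.
Proof. by move=> F; apply: tserP => n /=; rewrite scale1r. Qed.
Lemma tscalDr : right_distributive tscal +%R.
Proof. by move=> a F G; apply: tserP => n /=; rewrite scalerDr. Qed.
Lemma tscalDl F : {morph tscal^~ F : a b / a + b}.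
Proof. by move=> a b; apply: tserP => n /=; rewrite scalerDl. Qed.

(* [*:] on [tser V] is the coefficientwise action of k; the action of k[[t]] is
   [tscale] below. *)
HB.instance Definition _ :=
  GRing.Zmodule_isLmodule.Build k (tser V) tscalA tscal1 tscalDr tscalDl.

Definition tscale (c : tser k) (F : tser V) : tser V :=
  TSer (fun n => \sum_(i < n.+1) tcoef c i *: tcoef F (n - i)%N).
End TserLmod.

Section TserRing.
Variable k : comNzRingType.
Implicit Types f g h : tser k.

Definition tmul f g : tser k :=
  TSer (fun n => \sum_(i < n.+1) tcoef f i * tcoef g (n - i)%N).

Let trunc f n : {poly k} := \poly_(i < n) tcoef f i.

Lemma tmul_trunc f g n N : (n < N)%N ->
  tcoef (tmul f g) n = (trunc f N * trunc g N)`_n.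
Proof.
move=> nN; rewrite coefM /=; apply: eq_bigr => i _.
have iN : (i < N)%N by apply: leq_ltn_trans nN; rewrite -ltnS.
by rewrite !coef_poly iN (leq_ltn_trans (leq_subr i n) nN).
Qed.

Lemma tmulC : commutative tmul.
Proof.
move=> f g; apply: tserP => n.
by rewrite !(tmul_trunc _ _ (ltnSn n)) mulrC.
Qed.

Lemma tmulA : associative tmul.
Proof.
move=> f g h; apply: tserP => n.
have coefE f1 g1 m : (m < n.+1)%N ->
    (trunc (tmul f1 g1) n.+1)`_m = (trunc f1 n.+1 * trunc g1 n.+1)`_m.
  by move=> mn; rewrite -tmul_trunc // coef_poly mn.
rewrite !(tmul_trunc _ _ (ltnSn n)).
transitivity (trunc f n.+1 * (trunc g n.+1 * trunc h n.+1))`_n.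
  rewrite !coefM; apply: eq_bigr => i _; congr (_ * _).
  by rewrite coefE // ltnS leq_subr.
rewrite mulrA !coefM; apply: eq_bigr => i _; congr (_ * _).
by rewrite coefE.
Qed.

Lemma tmul1 : left_id (tconst 1) tmul.
Proof.
move=> f; apply: tserP => n /=.
rewrite big_ord_recl /= mul1r subn0 big1 ?addr0 // => i _.
by rewrite /= mul0r.
Qed.

Lemma tmulDl : left_distributive tmul +%R.
Proof.
move=> f g h; apply: tserP => n /=.
by rewrite -big_split; apply: eq_bigr => i _; rewrite mulrDl.
Qed.

Lemma tone_neq0 : tconst (1 : k) != 0.
Proof.
apply/eqP => /(congr1 (fun F => tcoef F 0%N)) /= /eqP.
by rewrite oner_eq0.
Qed.

HB.instance Definition _ :=
  GRing.Zmodule_isComNzRing.Build (tser k) tmulA tmulC tmul1 tmulDl tone_neq0.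

Definition tvar : tser k := TSer (fun n => if n == 1%N then 1 else 0).

Definition tgeom (a : k) : tser k := TSer (fun n => a ^+ n).

Lemma tgeomP (a : k) : (1 - tconst a * tvar) * tgeom a = 1.
Proof.
apply: tserP => n.
have cE m : tcoef (1 - tconst a * tvar) m =
    (m == 0%N)%:R - (if m == 1%N then a else 0).
  change (tcoef 1 m - tcoef (tmul (tconst a) tvar) m =
    (m == 0%N)%:R - (if m == 1%N then a else 0)).
  congr (_ - _); first by case: m.
  rewrite /= big_ord_recl /= subn0 big1 ?addr0 => [|i _]; last by rewrite mul0r.
  by case: eqP; rewrite ?mulr1 ?mulr0.
move: (1 - tconst a * tvar) cE => u cE.
change (\sum_(i < n.+1) tcoef u i * a ^+ (n - i) = tcoef (tconst 1) n).
rewrite big_ord_recl cE subr0 mul1r subn0.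
case: n => [|n]; first by rewrite big_ord0 addr0 expr0.
rewrite big_ord_recl cE sub0r subn1 mulNr big1 => [|i _].
  by rewrite addr0 -exprS addrN.
by rewrite cE subrr mul0r.
Qed.
End TserRing.

Definition tmap (V W : Type) (h : V -> W) (F : tser V) : tser W :=
  TSer (fun n => h (tcoef F n)).

Inductive aterm (k X : Type) :=
| TGen of X
| TScal of k
| TAdd of aterm k X & aterm k X
| TMul of aterm k X & aterm k X.
Arguments TGen {k X}.
Arguments TScal {k X} _%_ring_scope.

Declare Scope aterm_scope.
Delimit Scope aterm_scope with W.
Bind Scope aterm_scope with aterm.
Notation "a + b" := (TAdd a b) : aterm_scope.
Notation "a * b" := (TMul a b) : aterm_scope.
Notation "- a" := (TMul (TScal (-1)%R) a) : aterm_scope.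
Notation "a - b" := (TAdd a (TMul (TScal (-1)%R) b)) : aterm_scope.
Notation "1" := (TScal 1%R) : aterm_scope.

Section Terms.
Variables (k : comNzRingType) (X : Type).
Local Notation aterm := (aterm k X).

(* The congruence generated by the axioms of unital associative k-algebras and
   by the relations [rel]; the quotient of [aterm] by it is the free unital
   algebra on X modulo the ideal generated by the differences a - b for
   [rel a b]. *)
Inductive pres_eq (rel : aterm -> aterm -> Prop) : aterm -> aterm -> Prop :=
| pe_rel a b : rel a b -> pres_eq rel a b
| pe_refl a : pres_eq rel a a
| pe_sym a b : pres_eq rel a b -> pres_eq rel b a
| pe_trans b a c : pres_eq rel a b -> pres_eq rel b c -> pres_eq rel a c
| pe_add a a' b b' : pres_eq rel a a' -> pres_eq rel b b' ->
    pres_eq rel (a + b)%W (a' + b')%W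
| pe_mul a a' b b' : pres_eq rel a a' -> pres_eq rel b b' ->
    pres_eq rel (a * b)%W (a' * b')%W
| pe_addA a b c : pres_eq rel (a + (b + c))%W (a + b + c)%W
| pe_addC a b : pres_eq rel (a + b)%W (b + a)%W
| pe_add0 a : pres_eq rel (TScal 0 + a)%W a
| pe_addN a : pres_eq rel (- a + a)%W (TScal 0)
| pe_mulA a b c : pres_eq rel (a * (b * c))%W (a * b * c)%W
| pe_mul1l a : pres_eq rel (1 * a)%W a
| pe_mul1r a : pres_eq rel (a * 1)%W a
| pe_mulDl a b c : pres_eq rel ((a + b) * c)%W (a * c + b * c)%W
| pe_mulDr a b c : pres_eq rel (a * (b + c))%W (a * b + a * c)%W
| pe_scalD x y : pres_eq rel (TScal (x + y)) (TScal x + TScal y)%W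
| pe_scalM x y : pres_eq rel (TScal (x * y)) (TScal x * TScal y)%W
| pe_scalC x a : pres_eq rel (TScal x * a)%W (a * TScal x)%W.

Fixpoint teval (A : pzRingType) (s : k -> A) (h : X -> A) (u : aterm) : A :=
  match u with
  | TGen x => h x
  | TScal c => s c
  | TAdd a b => teval s h a + teval s h b
  | TMul a b => teval s h a * teval s h b
  end.

Lemma teval_pres_eq (rel : aterm -> aterm -> Prop) (A : pzRingType)
    (s : {rmorphism k -> A}) (h : X -> A) :
  (forall c a, s c * a = a * s c) ->
  (forall a b, rel a b -> teval s h a = teval s h b) ->
  forall a b, pres_eq rel a b -> teval s h a = teval s h b.
Proof.
move=> sC hrel a b; elim=> //= {a b}.
- by move=> b a c _ -> _ ->.
- by move=> a a' b b' _ -> _ ->.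
- by move=> a a' b b' _ -> _ ->.
- by move=> *; rewrite addrA.
- by move=> *; rewrite addrC.
- by move=> *; rewrite rmorph0 add0r.
- by move=> *; rewrite rmorphN rmorph1 mulN1r addNr rmorph0.
- by move=> *; rewrite mulrA.
- by move=> *; rewrite rmorph1 mul1r.
- by move=> *; rewrite rmorph1 mulr1.
- by move=> *; rewrite mulrDl.
- by move=> *; rewrite mulrDr.
- by move=> *; rewrite rmorphD.
- by move=> *; rewrite rmorphM.
Qed.

Fixpoint tanti (s : k -> k) (h : X -> aterm) (u : aterm) : aterm :=
  match u with
  | TGen x => h x
  | TScal c => TScal (s c)
  | TAdd a b => (tanti s h a + tanti s h b)%W
  | TMul a b => (tanti s h b * tanti s h a)%W
  end.

Lemma tanti_pres_eq (rel : aterm -> aterm -> Prop)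
    (s : {rmorphism k -> k}) (h : X -> aterm) :
  (forall a b, rel a b -> pres_eq rel (tanti s h a) (tanti s h b)) ->
  forall a b, pres_eq rel a b -> pres_eq rel (tanti s h a) (tanti s h b).
Proof.
move=> hrel a b; elim=> /= {a b}.
- by move=> *; apply: hrel.
- by move=> *; apply: pe_refl.
- by move=> *; apply: pe_sym.
- by move=> b a c _ ab _; apply: pe_trans.
- by move=> *; apply: pe_add.
- by move=> *; apply: pe_mul.
- by move=> *; apply: pe_addA.
- by move=> *; apply: pe_addC.
- by move=> c; rewrite rmorph0; apply: pe_add0.
- move=> c; rewrite rmorphN1 rmorph0.
  apply: pe_trans (pe_addN _ _); apply: pe_add; last exact: pe_refl.
  by apply: pe_sym; apply: pe_scalC.
- by move=> *; apply: pe_sym; apply: pe_mulA.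
- by move=> c; rewrite rmorph1; apply: pe_mul1r.
- by move=> c; rewrite rmorph1; apply: pe_mul1l.
- by move=> *; apply: pe_mulDr.
- by move=> *; apply: pe_mulDl.
- by move=> x y; rewrite rmorphD; apply: pe_scalD.
- by move=> x y; rewrite rmorphM mulrC; apply: pe_scalM.
- by move=> *; apply: pe_sym; apply: pe_scalC.
Qed.
End Terms.

(* Nontriviality is only there because MathComp algebras satisfy 1 <> 0. *)
Record presentation (k : comNzRingType) := Presentation {
  pgen : Type;
  prel : aterm k pgen -> aterm k pgen -> Prop;
  pnontriv : ~ pres_eq prel 1%W (TScal 0)
}.

HB.instance Definition _ (k X : Type) := gen_eqMixin (aterm k X).
HB.instance Definition _ (k X : Type) := gen_choiceMixin (aterm k X).

Section PresentedAlgebra.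
Variables (k : comNzRingType) (p : presentation k).
Local Notation T := (aterm k (pgen p)).
Local Notation "a ~~ b" := (pres_eq (@prel k p) a b) (at level 70).

Definition pequiv (a b : T) : bool := `[< a ~~ b >].

Lemma pequiv_is_equiv : equiv_class_of pequiv.
Proof.
split=> [a|a b|b a c].
- by apply/asboolP; apply: pe_refl.
- by apply/asboolP/asboolP => /pe_sym.
- by move=> /asboolP ab /asboolP bc; apply/asboolP; apply: pe_trans bc.
Qed.

Canonical pequiv_equiv := EquivRelPack pequiv_is_equiv.
Canonical pequiv_encModRel := defaultEncModRel pequiv.

Definition presAlg := {eq_quot pequiv}.
HB.instance Definition _ := Choice.on presAlg.
HB.instance Definition _ := EqQuotient.on presAlg.

Definition pi (a : T) : presAlg := \pi_presAlg a.

Lemma piP (a b : T) : pi a = pi b <-> a ~~ b.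
Proof.
split=> [/eqmodP /asboolP //|ab]; by apply/eqmodP/asboolP.
Qed.

Lemma pi_repr (x : presAlg) : pi (repr x) = x.
Proof. exact: reprK. Qed.

Lemma repr_pi (a : T) : repr (pi a) ~~ a.
Proof. by apply/piP; rewrite pi_repr. Qed.

Definition padd (x y : presAlg) := pi (repr x + repr y)%W.
Definition popp (x : presAlg) := pi (- repr x)%W.
Definition pmul (x y : presAlg) := pi (repr x * repr y)%W.
Definition pscale (c : k) (x : presAlg) := pi (TScal c * repr x)%W.

Lemma paddE a b : padd (pi a) (pi b) = pi (a + b)%W.
Proof. by apply/piP; apply: pe_add; apply: repr_pi. Qed.
Lemma poppE a : popp (pi a) = pi (- a)%W.
Proof. by apply/piP; apply: pe_mul (repr_pi _); apply: pe_refl. Qed.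
Lemma pmulE a b : pmul (pi a) (pi b) = pi (a * b)%W.
Proof. by apply/piP; apply: pe_mul; apply: repr_pi. Qed.
Lemma pscaleE c a : pscale c (pi a) = pi (TScal c * a)%W.
Proof. by apply/piP; apply: pe_mul (repr_pi _); apply: pe_refl. Qed.

Lemma pres_ind (P : presAlg -> Prop) : (forall a, P (pi a)) -> forall x, P x.
Proof. by move=> Pa x; rewrite -(pi_repr x). Qed.

Lemma paddA : associative padd.
Proof.
do 3![elim/pres_ind=> ?]; rewrite !paddE; apply/piP; exact: pe_addA.
Qed.
Lemma paddC : commutative padd.
Proof. do 2![elim/pres_ind=> ?]; rewrite !paddE; apply/piP; exact: pe_addC. Qed.
Lemma padd0 : left_id (pi (TScal 0)) padd.
Proof. elim/pres_ind=> ?; rewrite !paddE; apply/piP; exact: pe_add0. Qed.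
Lemma paddN : left_inverse (pi (TScal 0)) popp padd.
Proof. elim/pres_ind=> ?; rewrite poppE paddE; apply/piP; exact: pe_addN. Qed.

HB.instance Definition _ := GRing.isZmodule.Build presAlg paddA paddC padd0 paddN.

Lemma piD a b : pi (a + b)%W = pi a + pi b.
Proof. by rewrite -paddE. Qed.

Lemma pmulA : associative pmul.
Proof.
do 3![elim/pres_ind=> ?]; rewrite !pmulE; apply/piP; exact: pe_mulA.
Qed.
Lemma pmul1 : left_id (pi 1%W) pmul.
Proof. elim/pres_ind=> ?; rewrite !pmulE; apply/piP; exact: pe_mul1l. Qed.
Lemma pmulr1 : right_id (pi 1%W) pmul.
Proof. elim/pres_ind=> ?; rewrite !pmulE; apply/piP; exact: pe_mul1r. Qed.
Lemma pmulDl : left_distributive pmul padd.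
Proof.
do 3![elim/pres_ind=> ?]; rewrite !(paddE, pmulE); apply/piP; exact: pe_mulDl.
Qed.
Lemma pmulDr : right_distributive pmul padd.
Proof.
do 3![elim/pres_ind=> ?]; rewrite !(paddE, pmulE); apply/piP; exact: pe_mulDr.
Qed.
Lemma pone_neq0 : pi 1%W != pi (TScal 0).
Proof. by apply/eqP => /piP; apply: pnontriv. Qed.

HB.instance Definition _ := GRing.Zmodule_isNzRing.Build presAlg
  pmulA pmul1 pmulr1 pmulDl pmulDr pone_neq0.

Lemma pscaleA c d x : pscale c (pscale d x) = pscale (c * d) x.
Proof.
elim/pres_ind: x => a; rewrite !pscaleE; apply/piP.
apply: pe_trans (pe_mulA _ _ _ _) _; apply: pe_mul (pe_refl _ _).
exact/pe_sym/pe_scalM.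
Qed.
Lemma pscale1 : left_id 1 pscale.
Proof. elim/pres_ind=> a; rewrite pscaleE; apply/piP; exact: pe_mul1l. Qed.
Lemma pscaleDr : right_distributive pscale +%R.
Proof.
move=> c; do 2![elim/pres_ind=> ?].
by rewrite -piD !pscaleE -piD; apply/piP; apply: pe_mulDr.
Qed.
Lemma pscaleDl x : {morph pscale^~ x : c d / c + d}.
Proof.
elim/pres_ind: x => a c d; rewrite !pscaleE -piD.
apply/piP; apply: pe_trans (pe_mulDl _ _ _ _).
by apply: pe_mul (pe_refl _ _); apply: pe_scalD.
Qed.

HB.instance Definition _ := GRing.Zmodule_isLmodule.Build k presAlg
  pscaleA pscale1 pscaleDr pscaleDl.

Lemma pscaleAl c (x y : presAlg) : c *: (x * y) = (c *: x) * y.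
Proof.
elim/pres_ind: x => a; elim/pres_ind: y => b.
rewrite -[LHS]/(pscale c (pmul _ _)) -[RHS]/(pmul (pscale _ _) _).
rewrite !(pmulE, pscaleE); apply/piP; exact: pe_mulA.
Qed.

HB.instance Definition _ := GRing.Lmodule_isLalgebra.Build k presAlg pscaleAl.

Lemma pscaleAr c (x y : presAlg) : c *: (x * y) = x * (c *: y).
Proof.
elim/pres_ind: x => a; elim/pres_ind: y => b.
rewrite -[LHS]/(pscale c (pmul _ _)) -[RHS]/(pmul _ (pscale _ _)).
rewrite !(pmulE, pscaleE); apply/piP.
apply: pe_trans (pe_mulA _ _ _ _) _; apply: pe_trans (pe_sym (pe_mulA _ _ _ _)).
by apply: pe_mul (pe_refl _ _); apply: pe_scalC.
Qed.

HB.instance Definition _ := GRing.Lalgebra_isAlgebra.Build k presAlg pscaleAr.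

Lemma piM a b : pi (a * b)%W = pi a * pi b.
Proof. by rewrite -pmulE. Qed.
Lemma pi_scal c : pi (TScal c) = c%:A.
Proof.
rewrite -[RHS]/(pscale c (pi 1%W)) pscaleE; apply/piP.
exact/pe_sym/pe_mul1r.
Qed.
End PresentedAlgebra.

Section GeneratedSubalgebra.
Variables (k : comNzRingType) (A : algType k).

Inductive subalg_gen (x : A) : A -> Prop :=
| sg_gen : subalg_gen x x
| sg_one : subalg_gen x 1
| sg_add f g : subalg_gen x f -> subalg_gen x g -> subalg_gen x (f + g)
| sg_mul f g : subalg_gen x f -> subalg_gen x g -> subalg_gen x (f * g)
| sg_scale a f : subalg_gen x f -> subalg_gen x (a *: f).
End GeneratedSubalgebra.

Inductive sgen := gz | gzs.
Definition sgen_swap (x : sgen) := if x is gz then gzs else gz.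

Section InvolutivePresentation.
Variables (k : comNzRingType) (s : {rmorphism k -> k}) (sK : involutive s).

Definition tstar : aterm k sgen -> aterm k sgen :=
  tanti s (fun x => TGen (sgen_swap x)).

Lemma tstarK : involutive tstar.
Proof.
rewrite /tstar.
by elim=> [[]|c|a iha b ihb|a iha b ihb] //=; rewrite ?sK ?iha ?ihb.
Qed.

Variable rel : aterm k sgen -> aterm k sgen -> Prop.

(* An involutive algebra given by generators and relations also satisfies the
   adjoints of the relations. *)
Inductive star_closure : aterm k sgen -> aterm k sgen -> Prop :=
| sc_rel a b : rel a b -> star_closure a b
| sc_adj a b : rel a b -> star_closure (tstar a) (tstar b).

Lemma star_closureP a b : star_closure a b -> star_closure (tstar a) (tstar b).
Proof.
case=> c d cd; first exact: sc_adj.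
by rewrite !tstarK; apply: sc_rel.
Qed.

Lemma star_closure_nontriv :
  (forall a b, rel a b ->
     teval idfun (fun=> 1) a = teval idfun (fun=> 1) b) ->
  ~ pres_eq star_closure 1%W (TScal 0).
Proof.
move=> h H.
have starE c : teval idfun (fun=> 1) (tstar c) =
    s (teval idfun (fun=> 1) c) :> k.
  rewrite /tstar; elim: c => [x|c|a iha b ihb|a iha b ihb] //=.
  - by rewrite rmorph1.
  - by rewrite iha ihb rmorphD.
  - by rewrite iha ihb rmorphM mulrC.
have hs a b : star_closure a b ->
    teval idfun (fun=> 1) a = teval idfun (fun=> 1) b :> k.
  by case=> [c d /h //|c d /h cd]; rewrite !starE; congr (s _).
have := @teval_pres_eq _ _ _ _ idfun (fun=> 1) (fun c a => mulrC c a) hs _ _ H.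
by move=> /eqP /=; rewrite oner_eq0.
Qed.
End InvolutivePresentation.

Section Quantum.
Variables (R : realType) (q : R).
Local Notation C := R[i].
Local Notation conjC := (@conjc R).

Definition Pol_rel (a b : aterm C sgen) : Prop :=
  let z := TGen gz in let zs := TGen gzs in
  a = (zs * z)%W /\
  b = (TScal (q%:C ^+ 2) * (z * zs) + TScal (1 - q%:C ^+ 2))%W.

Lemma conjCK : involutive conjC.
Proof. exact: conjcK. Qed.

Lemma Pol_nontriv : ~ pres_eq (star_closure conjC Pol_rel) 1%W (TScal 0).
Proof.
apply: star_closure_nontriv => a b [-> ->] /=.
by rewrite !mulr1 addrC subrK.
Qed.

Definition Pol_pres : presentation C := Presentation Pol_nontriv.
Definition Pol : algType C := presAlg Pol_pres.

Definition Pz : Pol := pi (p := Pol_pres) (TGen gz).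
Definition Pzs : Pol := pi (p := Pol_pres) (TGen gzs).

Definition Pstar (f : Pol) : Pol := pi (p := Pol_pres) (tstar conjC (repr f)).

Lemma PstarE a : Pstar (pi (p := Pol_pres) a) = pi (p := Pol_pres) (tstar conjC a).
Proof.
apply/piP; apply: tanti_pres_eq; last exact: repr_pi.
by move=> c d /(star_closureP conjCK); apply: pe_rel.
Qed.

Lemma Pol_relE : Pzs * Pz = q%:C ^+ 2 *: (Pz * Pzs) + (1 - q%:C ^+ 2)%:A.
Proof.
have /piP : pres_eq (@prel _ Pol_pres) (TGen gzs * TGen gz)%W
    (TScal (q%:C ^+ 2) * (TGen gz * TGen gzs) + TScal (1 - q%:C ^+ 2))%W.
  by apply: pe_rel; apply: sc_rel; split.
by rewrite !(piD, piM, pi_scal) mulr_algl.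
Qed.

Inductive Ugen := gK | gKi | gE | gF.
Local Notation Uterm := (aterm C Ugen).
Local Notation K := (@TGen C Ugen gK).
Local Notation Ki := (@TGen C Ugen gKi).
Local Notation E := (@TGen C Ugen gE).
Local Notation F := (@TGen C Ugen gF).
Local Notation qC := (q%:C).

Inductive Uq_rel : Uterm -> Uterm -> Prop :=
| U_KKi : Uq_rel (K * Ki)%W 1%W
| U_KiK : Uq_rel (Ki * K)%W 1%W
| U_KE : Uq_rel (K * E)%W (TScal (qC ^+ 2) * (E * K))%W
| U_KiE : Uq_rel (Ki * E)%W (TScal (qC ^- 2) * (E * Ki))%W
| U_KF : Uq_rel (K * F)%W (TScal (qC ^- 2) * (F * K))%W
| U_KiF : Uq_rel (Ki * F)%W (TScal (qC ^+ 2) * (F * Ki))%W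
| U_EF : Uq_rel (E * F - F * E)%W (TScal (qC - qC^-1)^-1 * (K - Ki))%W.

Definition Ucounit : Uterm -> C :=
  teval idfun (fun x => match x with gK | gKi => 1 | gE | gF => 0 end).

Lemma Ucounit_pres_eq a b : pres_eq Uq_rel a b -> Ucounit a = Ucounit b.
Proof.
apply: teval_pres_eq => [c d|c d []] /=; first exact: mulrC.
all: by rewrite ?(mulr0, mul0r, mulr1, addr0, mulN1r, subrr).
Qed.

Lemma Uq_nontriv : ~ pres_eq Uq_rel 1%W (TScal 0).
Proof. by move=> /Ucounit_pres_eq /eqP /=; rewrite oner_eq0. Qed.

Definition Uq_pres : presentation C := Presentation Uq_nontriv.
Definition Uq : algType C := presAlg Uq_pres.
Definition Upi (u : Uterm) : Uq := pi (p := Uq_pres) u.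

(* The coproduct as an explicit sum of pure tensors: [:: (a1, b1); (a2, b2); ...]
   stands for a1 (x) b1 + a2 (x) b2 + ...  It is extended to all words as a
   morphism of algebras. *)
Fixpoint Ucoprod (u : Uterm) : seq (Uterm * Uterm) :=
  match u with
  | TGen gK => [:: (K, K)]
  | TGen gKi => [:: (Ki, Ki)]
  | TGen gE => [:: (E, 1%W); (K, E)]
  | TGen gF => [:: (F, Ki); (1%W, F)]
  | TScal c => [:: (TScal c, 1%W)]
  | TAdd a b => Ucoprod a ++ Ucoprod b
  | TMul a b => [seq ((x.1 * y.1)%W, (x.2 * y.2)%W) | x <- Ucoprod a, y <- Ucoprod b]
  end.

Definition Uantipode : Uterm -> Uterm :=
  tanti idfun (fun x => match x with
    | gK => Ki
    | gKi => K
    | gE => (- (Ki * E))%W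
    | gF => (- (F * K))%W
    end).

Definition Ustar : Uterm -> Uterm :=
  tanti conjC (fun x => match x with
    | gK => K
    | gKi => Ki
    | gE => (- (K * F))%W
    | gF => (- (E * Ki))%W
    end).

Definition is_Uq_module (V : lmodType C) (act : Uq -> V -> V) : Prop :=
  [/\ forall u, linear (act u),
      forall v, linear (act^~ v),
      forall v, act 1 v = v &
      forall u u' v, act (u * u') v = act u (act u' v)].

(* All words u are considered, so Upi u ranges over the whole of U_q sl_2. *)
Definition is_Uq_module_algebra (V : lmodType C) (mul : V -> V -> V) (one : V)
    (act : Uq -> V -> V) : Prop :=
  [/\ is_Uq_module act,
      forall u f g, act (Upi u) (mul f g) =
        \sum_(x <- Ucoprod u) mul (act (Upi x.1) f) (act (Upi x.2) g) &
      forall u, act (Upi u) one = Ucounit u *: one].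

(* These conditions determine the action uniquely. *)
Definition is_Pol_action (act : Uq -> Pol -> Pol) : Prop :=
  [/\ is_Uq_module_algebra *%R 1 act,
      forall u f, Pstar (act (Upi u) f) =
                  act (Upi (Ustar (Uantipode u))) (Pstar f),
      act (Upi K) Pz = qC ^+ 2 *: Pz /\ act (Upi Ki) Pz = qC ^- 2 *: Pz,
      act (Upi E) Pz = - (Num.sqrt q)%:C *: Pz ^+ 2 &
      act (Upi F) Pz = (Num.sqrt q)%:C *: 1].

Local Notation PolT := (tser Pol).

Definition is_deformation (star : PolT -> PolT -> PolT) : Prop :=
  [/\ associative star,
      (forall (c : tser C) f f' g,
         star (tscale c f + f') g = tscale c (star f g) + star f' g),
      (forall (c : tser C) f g g',
         star f (tscale c g + g') = tscale c (star f g) + star f g'),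
      tadic_continuous2 star &
      forall f g : Pol, tcoef (star (tconst f) (tconst g)) 0 = f * g].

(* The bilinear maps m_i (with m_0 the product of Pol(C)_q). *)
Definition deform_coef (star : PolT -> PolT -> PolT) (i : nat) (f g : Pol) : Pol :=
  tcoef (star (tconst f) (tconst g)) i.

Definition separates_variables (star : PolT -> PolT -> PolT) : Prop :=
  forall f g : Pol, subalg_gen Pz f \/ subalg_gen Pzs g ->
    star (tconst f) (tconst g) = tconst (f * g).

Definition is_real (star : PolT -> PolT -> PolT) : Prop :=
  forall f g : Pol, tmap Pstar (star (tconst f) (tconst g)) =
    star (tconst (Pstar g)) (tconst (Pstar f)).

Definition is_covariant (act : Uq -> Pol -> Pol) (star : PolT -> PolT -> PolT) :=
  is_Uq_module_algebra star (tconst 1) (fun u => tmap (act u)).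

Definition tconj : tser C -> tser C := tmap conjC.

Lemma tconj_additive : zmod_morphism tconj.
Proof. by move=> f g; apply: tserP => n /=; rewrite rmorphB. Qed.
Lemma tconj_multiplicative : monoid_morphism tconj.
Proof.
split=> [|f g]; apply: tserP => n; last first.
  by rewrite /= rmorph_sum; apply: eq_bigr => i _; rewrite rmorphM.
case: n => [|n].
  exact: (rmorph1 conjC).
exact: (rmorph0 conjC).
Qed.
HB.instance Definition _ :=
  GRing.isZmodMorphism.Build (tser C) (tser C) tconj tconj_additive.
HB.instance Definition _ :=
  GRing.isMonoidMorphism.Build (tser C) (tser C) tconj tconj_multiplicative.

(* (1 - q^2) t / (1 - q^2 t), see [tgeomP]. *)
Definition BPol_coef : tser C :=
  tconst (1 - qC ^+ 2) * tvar C * tgeom (qC ^+ 2).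

Definition BPol_rel (a b : aterm (tser C) sgen) : Prop :=
  let z := TGen gz in let zs := TGen gzs in
  a = (zs * z)%W /\
  b = (TScal (tconst (qC ^+ 2)) * (z * zs) + TScal (tconst (1 - qC ^+ 2))
       + TScal BPol_coef * ((1 - zs * z) * (1 - z * zs)))%W.

Lemma BPol_nontriv : ~ pres_eq (star_closure tconj BPol_rel) 1%W (TScal 0).
Proof.
apply: star_closure_nontriv => a b [-> ->] /=.
rewrite !mulr1 subrr !mulr0 addr0; apply: tserP => -[|n] /=.
  by rewrite addrC subrK.
by rewrite addr0.
Qed.

Definition BPol_pres : presentation (tser C) := Presentation BPol_nontriv.
Definition BPol : algType (tser C) := presAlg BPol_pres.
Definition Bz : BPol := pi (p := BPol_pres) (TGen gz).
Definition Bzs : BPol := pi (p := BPol_pres) (TGen gzs).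

Lemma BPol_relE : Bzs * Bz =
  tconst (qC ^+ 2) *: (Bz * Bzs) + (tconst (1 - qC ^+ 2))%:A
  + BPol_coef *: ((1 - Bzs * Bz) * (1 - Bz * Bzs)).
Proof.
have /piP : pres_eq (@prel _ BPol_pres) (TGen gzs * TGen gz)%W
    (TScal (tconst (qC ^+ 2)) * (TGen gz * TGen gzs) + TScal (tconst (1 - qC ^+ 2))
     + TScal BPol_coef * ((1 - TGen gzs * TGen gz) * (1 - TGen gz * TGen gzs)))%W.
  by apply: pe_rel; apply: sc_rel; split.
by rewrite !(piD, piM, pi_scal) !mulr_algl !scaleN1r scale1r.
Qed.

Definition Beqmod (n : nat) (a b : BPol) : Prop :=
  exists c : BPol, a - b = tvar C ^+ n *: c.

(* I : z^i z*^j |-> z^i z*^j, as a map on Pol(C)_q; its C[[t]]-linear extension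
   is the map P -> BPol. *)
Definition is_ordering_map (I : Pol -> BPol) : Prop :=
  (forall a f g, I (a *: f + g) = tconst a *: I f + I g) /\
  (forall i j, I (Pz ^+ i * Pzs ^+ j) = Bz ^+ i * Bzs ^+ j).

(* A representative in BPol of the image of f modulo t^n under I_oo. *)
Definition Iinfty (I : Pol -> BPol) (n : nat) (f : PolT) : BPol :=
  \sum_(i < n) tvar C ^+ i *: I (tcoef f i).

(* [star] satisfies I_oo (f * g) = I_oo f . I_oo g in the t-adic completion of
   BPol, i.e. in the inverse limit of the BPol / t^n BPol; as I_oo is bijective
   this determines [star]. *)
Definition is_Berezin (star : PolT -> PolT -> PolT) : Prop :=
  exists I : Pol -> BPol, is_ordering_map I /\
    forall f g n, Beqmod n (Iinfty I n (star f g)) (Iinfty I n f * Iinfty I n g).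

End Quantum.

(* Main.v *)
Require Import Defs.
From HB Require Import structures.
From mathcomp Require Import all_boot all_order all_algebra.
From mathcomp Require Import boolp reals.
From mathcomp.real_closed Require Import complex.
From mathcomp Require Import ring.
Set Implicit Arguments.
Unset Strict Implicit.
Unset Printing Implicit Defensive.
Import Order.TTheory GRing.Theory Num.Theory.
Local Open Scope ring_scope.

(** Let w be the adjoint of z and y = 1 - z w, so that 1 - w z = q^2 y in
    Pol(C)_q. For the product of a given deformation let y' = 1 - w z. By
    separation of variables the product is governed by the series w z, hence by
    y', and covariance forces a relation
      y' = q^2 y - phi(t) y' y,  phi(0) = 0.                              (R)
    This is the defining relation of the Berezin algebra with the coefficient
    (1 - q^2) t / (1 - q^2 t) replaced by phi; the two coefficients correspond
    under t |-> c(t), where c = phi / (1 - q^2 + q^2 phi).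

    To find (R), observe that y' - q^2 y and y' y both satisfy the linear
    equation
      F x = - q^(1/2) (w x + q^2 x w),  K x = x                           (E)
    exactly, whatever the deformation is. Modulo t, (E) is an equation in
    Pol(C)_q. Its solutions are K-invariant, so they are polynomials in y, and F
    acts on y^n w so that only y^2 survives ([cocycle_classification]; the
    independence of the y^n w is seen in the Fock representation). As y' y has
    constant term q^2 y^2, dividing by t repeatedly shows that the solutions of
    (E) are the multiples psi(t) y' y ([invariant_solution_span]), which is (R)
    with phi = - psi.

    By (R), z |-> z, w |-> w and t |-> c(t) define a ring morphism rho from
    the Berezin algebra to (Pol(C)_q[[t]], star) ([BPol_to_star]); the adjoint
    relation holds as well, because (R) forces y' y = y y'. Separation of
    variables gives rho (I f) = f on the spanning monomials z^i w^j, hence for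
    all f. Applying rho to
      I f . I g = sum_(i < n) t^i I (m_i (f, g))  modulo t^n
    yields f star g = sum_(i < n) c^i m_i (f, g) modulo c^n, hence modulo t^n. *)

(** * Formal power series *)

Section Tscale.
Variables (k : comNzRingType) (V : lmodType k).
Implicit Types (c d : tser k) (F G : tser V).

Lemma tcoefD (W : zmodType) (F G : tser W) n :
  tcoef (F + G) n = tcoef F n + tcoef G n.
Proof. by []. Qed.

Lemma tcoefN (W : zmodType) (F : tser W) n : tcoef (- F) n = - tcoef F n.
Proof. by []. Qed.

Lemma tcoef_sum (W : zmodType) I r (P : pred I) (u : I -> tser W) n :
  tcoef (\sum_(i <- r | P i) u i) n = \sum_(i <- r | P i) tcoef (u i) n.
Proof. exact: (@big_morph _ _ (fun F : tser W => tcoef F n) 0 +%R 0 +%R). Qed.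

Lemma tconst0 (W : zmodType) : tconst (0 : W) = 0.
Proof. by apply: tserP => -[]. Qed.

Lemma tconstD (W : zmodType) (v w : W) : tconst (v + w) = tconst v + tconst w.
Proof. by apply: tserP => -[|n] //=; rewrite addr0. Qed.

Lemma tconstN (W : zmodType) (v : W) : tconst (- v) = - tconst v.
Proof. by apply: tserP => -[|n] //=; rewrite oppr0. Qed.

Lemma tmulE c d : c * d = tscale c (d : tser k^o).
Proof. by []. Qed.

Lemma tscaleDl c d F : tscale (c + d) F = tscale c F + tscale d F.
Proof.
apply: tserP => n /=; rewrite -big_split; apply: eq_bigr => i _.
by rewrite scalerDl.
Qed.

Lemma tscaleDr c F G : tscale c (F + G) = tscale c F + tscale c G.
Proof.
apply: tserP => n /=; rewrite -big_split; apply: eq_bigr => i _.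
by rewrite scalerDr.
Qed.

Lemma tscale_const a F : tscale (tconst a) F = a *: F.
Proof.
apply: tserP => n /=; rewrite big_ord_recl subn0 big1 ?addr0 // => i _.
by rewrite /= scale0r.
Qed.

Lemma tscale1 F : tscale 1 F = F.
Proof. by rewrite (tscale_const 1) scale1r. Qed.

Lemma tscale_map (W : lmodType k) (h : {linear V -> W}) c F :
  tmap h (tscale c F) = tscale c (tmap h F).
Proof.
apply: tserP => n /=; rewrite linear_sum; apply: eq_bigr => i _.
by rewrite linearZ.
Qed.

Lemma tcoef_tscale0 c F : tcoef (tscale c F) 0 = tcoef c 0 *: tcoef F 0.
Proof. by rewrite /= big_ord_recl big_ord0 addr0. Qed.

Lemma tcoef_tvar0 F : tcoef (tscale (tvar k) F) 0 = 0.
Proof. by rewrite tcoef_tscale0 scale0r. Qed.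

Lemma tcoef_tvarS F n : tcoef (tscale (tvar k) F) n.+1 = tcoef F n.
Proof.
rewrite /= !big_ord_recl big1 /= ?scale0r ?add0r ?scale1r ?addr0 ?subn1 //.
by move=> i _; rewrite scale0r.
Qed.

Definition tshift (W : Type) (F : tser W) : tser W :=
  TSer (fun n => tcoef F n.+1).

(** Most facts about products of series are proved by induction on the
    coefficient, peeling off the constant term with this decomposition. *)
Lemma tser_split F : F = tconst (tcoef F 0) + tscale (tvar k) (tshift F).
Proof.
apply: tserP => -[|n]; first by rewrite tcoefD tcoef_tvar0 addr0.
by rewrite tcoefD tcoef_tvarS add0r.
Qed.

Lemma tscale_teqmod0 m n c F :
  teqmod m c 0 -> teqmod n F 0 -> teqmod (m + n) (tscale c F) 0.
Proof.
move=> c0 F0 l lmn; apply: big1 => i _ /=.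
have [im|mi] := ltnP i m; first by rewrite c0 // scale0r.
rewrite F0 ?scaler0 // ltn_subLR; last by rewrite -ltnS.
by rewrite (leq_trans lmn) // leq_add2r.
Qed.

End Tscale.

Section Substitution.
Variable k : comNzRingType.
Implicit Types (c f g : tser k) (p : {poly k}).

Lemma tconst_zmod_morphism : zmod_morphism (@tconst k).
Proof. by move=> a b; rewrite tconstD tconstN. Qed.

Lemma tconst_monoid_morphism : monoid_morphism (@tconst k).
Proof.
split=> // a b; rewrite tmulE tscale_const.
by apply: tserP => -[|n] //=; rewrite scaler0.
Qed.

HB.instance Definition _ :=
  GRing.isZmodMorphism.Build k (tser k) (@tconst k) tconst_zmod_morphism.
HB.instance Definition _ :=
  GRing.isMonoidMorphism.Build k (tser k) (@tconst k) tconst_monoid_morphism.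

Lemma tcoef_constM a f n : tcoef (tconst a * f) n = a * tcoef f n.
Proof. by rewrite tmulE tscale_const. Qed.

Lemma teqmod_exp c n : tcoef c 0 = 0 -> teqmod n (c ^+ n) 0.
Proof.
move=> c0; elim: n => [|n IHn] // ; rewrite exprS tmulE -add1n.
by apply: (@tscale_teqmod0 k k^o 1 n c) IHn => -[].
Qed.

(** The series f(c(t)). The sum stops at n because c^i vanishes to order i when
    c(0) = 0. *)
Definition tsubst c f : tser k :=
  TSer (fun n => \sum_(i < n.+1) tcoef f i * tcoef (c ^+ i) n).

Definition ttrunc N f : {poly k} := \poly_(i < N) tcoef f i.

Definition teval_poly c p : tser k := (map_poly (@tconst k) p).[c].

(** Modulo t^N the substitution is evaluation of a polynomial, which is how
    it is seen to be multiplicative. *)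
Lemma tcoef_teval_poly c p n : tcoef c 0 = 0 ->
  tcoef (teval_poly c p) n = \sum_(i < n.+1) p`_i * tcoef (c ^+ i) n.
Proof.
move=> c0; rewrite /teval_poly (horner_coef_wide c (size_poly _ _)) tcoef_sum.
have cE i : tcoef ((map_poly (@tconst k) p)`_i * c ^+ i) n =
    p`_i * tcoef (c ^+ i) n.
  by rewrite coef_map tcoef_constM.
under eq_bigr do rewrite cE.
have ext m N : (m <= N)%N -> (forall i, (m <= i < N)%N ->
    p`_i * tcoef (c ^+ i) n = 0) ->
    \sum_(i < N) p`_i * tcoef (c ^+ i) n = \sum_(i < m) p`_i * tcoef (c ^+ i) n.
  move=> mN z; rewrite (big_ord_widen N (fun i => p`_i * tcoef (c ^+ i) n) mN).
  rewrite [RHS]big_mkcond /=.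
  by apply: eq_bigr => i _; case: ltnP => // mi; rewrite z // mi /=.
have h1 := ext (size p) _ (leq_maxl _ n.+1); rewrite -h1; last first.
  by move=> i /andP[/leq_sizeP -> //]; rewrite mul0r.
rewrite (ext n.+1) ?leq_maxr // => i /andP[ni _].
by rewrite (teqmod_exp c0) ?mulr0.
Qed.

Lemma tsubst_ttrunc c f n N : tcoef c 0 = 0 -> (n < N)%N ->
  tcoef (tsubst c f) n = tcoef (teval_poly c (ttrunc N f)) n.
Proof.
move=> c0 nN; rewrite tcoef_teval_poly //; apply: eq_bigr => i _.
by rewrite coef_poly (leq_trans (ltn_ord i)).
Qed.

Lemma tsubstB c f g : tsubst c (f - g) = tsubst c f - tsubst c g.
Proof.
apply: tserP => n; rewrite tcoefD tcoefN /= -sumrB.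
by apply: eq_bigr => i _; rewrite mulrBl.
Qed.

Lemma tsubst_const c a : tsubst c (tconst a) = tconst a.
Proof.
apply: tserP => n /=; rewrite big_ord_recl big1 => [|i _]; last first.
  by rewrite /= mul0r.
by case: n => [|n]; rewrite /= ?mulr1 ?mulr0 addr0.
Qed.

Lemma tsubstM c f g : tcoef c 0 = 0 ->
  tsubst c (f * g) = tsubst c f * tsubst c g.
Proof.
move=> c0; apply: tserP => n.
have -> : tcoef (tsubst c f * tsubst c g) n =
    tcoef (teval_poly c (ttrunc n.+1 f) * teval_poly c (ttrunc n.+1 g)) n.
  apply: eq_bigr => i _.
  by rewrite !(@tsubst_ttrunc _ _ _ n.+1) // ltnS leq_subr.
rewrite /teval_poly -hornerM -rmorphM -/(teval_poly _ _) tcoef_teval_poly //.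
apply: eq_bigr => i _.
by rewrite -tmul_trunc // ltn_ord.
Qed.

Lemma tsubst_tvar c : tcoef c 0 = 0 -> tsubst c (tvar k) = c.
Proof.
move=> c0; apply: tserP => -[|n] /=.
  by rewrite big_ord_recl big_ord0 addr0 mul0r.
rewrite !big_ord_recl big1 /= ?mul0r ?add0r ?mul1r ?addr0 //.
by move=> i _; rewrite mul0r.
Qed.

End Substitution.

(** The inverse is a substitution into the geometric series: if f(0) = a, then
    f = a (1 - u) with u(0) = 0. *)
Lemma tser_inv (k : comUnitRingType) (f : tser k) :
  tcoef f 0 \is a GRing.unit -> exists g, f * g = 1.
Proof.
move=> f0U; pose u := 1 - tconst (tcoef f 0)^-1 * f.
have u0 : tcoef u 0 = 0.
  by rewrite tcoefD tcoefN tcoef_constM mulVr // subrr.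
exists (tconst (tcoef f 0)^-1 * tsubst u (tgeom 1)).
have := congr1 (tsubst u) (tgeomP (1 : k)).
rewrite tsubstM // tsubstB tsubstM // tsubst_tvar // !tsubst_const mul1r.
by rewrite {1}/u subKr [_ * f]mulrC -mulrA => ->.
Qed.

(** * Twisted derivations of disc-like algebras *)

(** The identities behind (E) follow from the twisted Leibniz rule and the action
    on the generators alone. They are stated for any algebra so as to apply both
    to Pol(C)_q and to its deformation. Here D is the action of F, L that of K^-1
    (or, with Q and Qi exchanged, of K), s is q^(1/2), and Q and Qi are q^2 and
    q^-2. *)
Section DiscDerivation.
Variables (k : comNzRingType) (A : algType k) (D L : {linear A -> A}).
Variables (s Q Qi : k) (z w : A).
Hypothesis QQi : Q * Qi = 1.
Hypothesis DM : forall x y, D (x * y) = D x * L y + x * D y.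
Hypothesis LM : forall x y, L (x * y) = L x * L y.
Hypotheses (D1 : D 1 = 0) (L1 : L 1 = 1).
Hypotheses (Dz : D z = s *: 1) (Dw : D w = - (s * Q) *: (w * w)).
Hypotheses (Lz : L z = Qi *: z) (Lw : L w = Q *: w).
Let y := 1 - z * w.
Let y' := 1 - w * z.

Lemma disc_L_y : L y = y.
Proof.
by rewrite linearB L1 LM Lz Lw -scalerAl -scalerAr scalerA mulrC QQi scale1r.
Qed.

Lemma disc_L_y' : L y' = y'.
Proof.
by rewrite linearB L1 LM Lz Lw -scalerAl -scalerAr scalerA QQi scale1r.
Qed.

Lemma disc_D_y : D y = - (s * Q) *: (y * w).
Proof.
rewrite linearB D1 DM Dz Dw Lw -scalerAl mul1r scalerA -scalerAr mulrA sub0r.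
by rewrite mulrBl mul1r !scaleNr scalerBr.
Qed.

Lemma disc_D_y' : D y' = - s *: (w * y').
Proof.
rewrite linearB D1 DM Dz Dw Lz -scalerAl -scalerAr scalerA -scalerAr mulr1.
rewrite mulNr -mulrA QQi mulr1 sub0r mulrBr mulr1 -mulrA.
by rewrite scalerBr !scaleNr opprD opprK addrC.
Qed.

(** The first half of the equation (E). *)
Definition disc_solution (x : A) := D x = - s *: (w * x + Q *: (x * w)).

Lemma disc_solution_lin a x x' :
  disc_solution x -> disc_solution x' -> disc_solution (a *: x + x').
Proof.
rewrite /disc_solution => Dx Dx'; rewrite linearP Dx Dx' scalerA [a * _]mulrC.
rewrite -(scalerA (- s)) -scalerDr; congr (_ *: _).
rewrite mulrDr mulrDl -scalerAr -scalerAl scalerDr [Q *: (_ + _)]scalerDr.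
by rewrite !scalerA mulrC addrACA.
Qed.

Lemma disc_solution_yy : disc_solution (y' * y).
Proof.
rewrite /disc_solution DM disc_D_y' disc_D_y disc_L_y -scalerAl -scalerAr.
by rewrite scalerDr scalerA mulNr !mulrA.
Qed.

(** The terms w y and y' w agree, both being w - w z w; this makes the mixed terms
    cancel. *)
Lemma disc_solution_diff : disc_solution (y' - Q *: y).
Proof.
have wy : w * y = y' * w by rewrite mulrBr mulrBl mulr1 mul1r mulrA.
rewrite /disc_solution linearB linearZ /= disc_D_y' disc_D_y.
rewrite (mulrBr w y') (mulrBl w y') -scalerAr -scalerAl wy.
rewrite (scalerBr Q (y' * w)) scalerA addrA subrK.
by rewrite scalerBr !scalerA; congr (_ - _ *: _); ring.
Qed.

(** The factor (1 - Q) clears the denominator of the q-integer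
    (1 - Q^n) / (1 - Q). *)
Lemma disc_D_exp n :
    (forall n, w * y ^+ n = Q ^+ n *: (y ^+ n * w)) ->
  (1 - Q) *: D (y ^+ n) = - (s * Q * (1 - Q ^+ n)) *: (y ^+ n * w).
Proof.
move=> wy; have Lyn m : L (y ^+ m) = y ^+ m.
  by elim: m => [|m IH]; rewrite ?expr0 // exprS LM IH disc_L_y.
elim: n => [|n IHn]; first by rewrite expr0 D1 subrr mulr0 oppr0 scale0r scaler0.
rewrite exprS DM Lyn disc_D_y scalerDr (scalerAr (1 - Q) y) IHn -scalerAl -(mulrA y w) wy.
rewrite -!scalerAr !scalerA (mulrA y) -scalerDl -!exprS; congr (_ *: _).
by rewrite !exprS; ring.
Qed.
End DiscDerivation.

(** * The algebra Pol(C)_q *)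

Section QuantumDisc.
Variables (R : realType) (q : R).
Hypothesis hq : 0 < q < 1.
Local Open Scope complex_scope.
Local Notation C := R[i].
Local Notation Q := (q%:C ^+ 2).
Local Notation z := (Pz q).
Local Notation w := (Pzs q).
Local Notation y := (1 - z * w).

Lemma Q_gt0 : 0 < Q :> C.
Proof. by rewrite exprn_gt0 // ltcR; case/andP: hq. Qed.

Lemma Q_lt1 : Q < 1 :> C.
Proof.
have /andP[q0 q1] := hq.
by rewrite expr_lt1 ?ltcR ?lecR // ltW.
Qed.

Lemma Q_neq0 : Q != 0 :> C. Proof. exact: lt0r_neq0 Q_gt0. Qed.

Lemma subr1Q_neq0 : 1 - Q != 0 :> C.
Proof. by rewrite subr_eq0 eq_sym lt_eqF // Q_lt1. Qed.

Lemma Q_exp_inj : injective (fun n => Q ^+ n : C).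
Proof.
move=> m n /= eQ; apply/eqP; rewrite eqn_leq.
by rewrite -!(ler_iXn2l Q_gt0 Q_lt1) eQ lexx.
Qed.

Lemma conjQ : conjc Q = Q :> C.
Proof. by rewrite rmorphXn; congr (_ ^+ 2); apply: conjc_real. Qed.

Lemma conj1Q : conjc (1 - Q) = 1 - Q :> C.
Proof. by rewrite rmorphB rmorph1 -[in RHS]conjQ. Qed.

(** The Fock representation on sequences, in which y is diagonal with the
    distinct eigenvalues q^(2n). Finite-dimensional representations over
    characteristic 0 would not do: there y is nilpotent. *)
Fixpoint fock (u : aterm C sgen) (f : nat -> C) : nat -> C :=
  match u with
  | TGen gz => fun n => (1 - Q ^+ n) * f n.-1
  | TGen gzs => fun n => f n.+1
  | TScal c => fun n => c * f n
  | TAdd a b => fun n => fock a f n + fock b f n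
  | TMul a b => fock a (fock b f)
  end.

Lemma fock_linear u c f g :
  fock u (fun n => c * f n + g n) = fun n => c * fock u f n + fock u g n.
Proof.
elim: u f g => [[]|d|a iha b ihb|a iha b ihb] f g //=; last by rewrite ihb iha.
all: by apply: funext => n; rewrite ?iha ?ihb; ring.
Qed.

Lemma fock_pres_eq a b : pres_eq (star_closure (@conjc R) (Pol_rel q)) a b ->
  fock a = fock b.
Proof.
have fockZ u c f : fock u (fun n => c * f n) = fun n => c * fock u f n.
  have -> : (fun n => c * f n) = (fun n => c * f n + (fun=> 0) n).
    by apply: funext => n; rewrite addr0.
  rewrite fock_linear.
  have -> : (fun=> 0 : C) = (fun n : nat => -1 * f n + f n).
    by apply: funext => n; ring.
  by apply: funext => n; rewrite fock_linear; ring.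
have fockD u f g : fock u (fun n => f n + g n) = fun n => fock u f n + fock u g n.
  have := fock_linear u 1 f g.
  have -> : (fun n => 1 * f n + g n) = (fun n => f n + g n).
    by apply: funext => n; rewrite mul1r.
  by move=> ->; apply: funext => n; rewrite mul1r.
elim=> {a b} /=.
- have rel : forall a b, Pol_rel q a b -> fock a = fock b.
    move=> _ _ [-> ->]; apply: funext => f; apply: funext => n /=.
    by case: n => [|n] /=; rewrite exprS ?expr0; ring.
  move=> _ _ [a b /rel //|a b [-> ->]].
  have -> : tstar (@conjc R) (TScal Q * (TGen gz * TGen gzs) + TScal (1 - Q))%W
      = (TGen gz * TGen gzs * TScal Q + TScal (1 - Q))%W.
    by congr (_ * TScal _ + TScal _)%W; [exact: conjQ | exact: conj1Q].
  apply: funext => f; apply: funext => n; cbn [fock].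
  by case: n => [|n] /=; rewrite exprS ?expr0; ring.
- by [].
- by move=> a b _ ->.
- by move=> b a c _ -> _ ->.
- by move=> a a' b b' _ -> _ ->.
- by move=> a a' b b' _ -> _ ->.
- by move=> a b c; do 2![apply: funext => ?]; rewrite addrA.
- by move=> a b; do 2![apply: funext => ?]; rewrite addrC.
- by move=> a; do 2![apply: funext => ?]; rewrite mul0r add0r.
- by move=> a; do 2![apply: funext => ?]; rewrite mul0r mulN1r addNr.
- by [].
- by move=> a; do 2![apply: funext => ?]; rewrite mul1r.
- move=> a; apply: funext => f; congr (fock a _).
  by apply: funext => ?; rewrite mul1r.
- by [].
- by move=> a b c; apply: funext => f; rewrite fockD.
- by move=> a b; do 2![apply: funext => ?]; rewrite mulrDl.
- by move=> a b; do 2![apply: funext => ?]; rewrite mulrA.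
- by move=> c a; apply: funext => f; rewrite fockZ.
Qed.

Definition fockP (x : Pol q) := fock (repr x).

Lemma fockP_pi a : fockP (Defs.pi (p := Pol_pres q) a) = fock a.
Proof. by apply: fock_pres_eq; exact: (@Defs.repr_pi _ (Pol_pres q) a). Qed.

Lemma fockPD x x' f n : fockP (x + x') f n = fockP x f n + fockP x' f n.
Proof.
elim/pres_ind: x => a; elim/pres_ind: x' => b.
by rewrite -piD !fockP_pi.
Qed.

Lemma fockPM x x' f : fockP (x * x') f = fockP x (fockP x' f).
Proof.
elim/pres_ind: x => a; elim/pres_ind: x' => b.
by rewrite -piM !fockP_pi.
Qed.

Lemma fockPZ c x f n : fockP (c *: x) f n = c * fockP x f n.
Proof.
by rewrite -mulr_algl fockPM -(@pi_scal _ (Pol_pres q)) fockP_pi.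
Qed.

Lemma fockP1 f : fockP 1 f = f.
Proof.
rewrite -[fockP 1]/(fockP (Defs.pi (p := Pol_pres q) 1%W)) fockP_pi /=.
by apply: funext => n; rewrite mul1r.
Qed.

Lemma fockP_y f n : fockP y f n = Q ^+ n * f n.
Proof.
rewrite fockPD -scaleN1r fockPZ fockPM !fockP_pi /=.
by case: n => [|n] /=; rewrite ?expr0; ring.
Qed.

(** At the constant sequence 1, the combination of the y^i w gives the values of the
    polynomial with the same coefficients at the points q^(2m), of which there
    are infinitely many. *)
Lemma yw_free n (a : nat -> C) :
  \sum_(i < n) a i *: (y ^+ i * w) = 0 -> forall i, (i < n)%N -> a i = 0.
Proof.
move=> a0 i ltin; pose p : {poly C} := \poly_(i < n) a i.
have root_p m : root p (Q ^+ m).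
  rewrite /root horner_poly; apply/eqP.
  transitivity (fockP (\sum_(i < n) a i *: (y ^+ i * w)) (fun=> 1) m); last first.
    by rewrite a0 -(scale0r 0) fockPZ mul0r.
  rewrite (@big_morph _ _ (fun x => fockP x (fun=> 1) m) 0 +%R).
  - apply: eq_bigr => l _; rewrite fockPZ fockPM; congr (_ * _).
    elim: (nat_of_ord l) => [|l' IHl]; first by rewrite !expr0 fockP1 fockP_pi.
    by rewrite [in RHS]exprS fockPM fockP_y -IHl exprS.
  - by move=> x x'; rewrite fockPD.
  - by rewrite -(scale0r 0) fockPZ mul0r.
have /(congr1 (fun r : {poly C} => r`_i)) : p = 0; last by rewrite coef_poly ltin coef0.
apply: (@roots_geq_poly_eq0 _ p [seq Q ^+ n | n <- iota 0 n]).
- by apply/allP => _ /mapP[m _ ->].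
- by rewrite map_inj_uniq ?iota_uniq //; apply: Q_exp_inj.
- by rewrite size_map size_iota size_poly.
Qed.

Lemma wz_eq : w * z = Q *: (z * w) + (1 - Q)%:A.
Proof. exact: Pol_relE. Qed.

Lemma subr_wz : 1 - w * z = Q *: y.
Proof.
by rewrite wz_eq scalerBl scale1r addrCA opprD addrA subrr sub0r opprB -scalerBr.
Qed.

Lemma wy_eq : w * y = Q *: (y * w).
Proof. by rewrite mulrBr mulr1 mulrA -{1}[w]mul1r -mulrBl subr_wz scalerAl. Qed.

Lemma zy_eq : Q *: (z * y) = y * z.
Proof. by rewrite scalerAr -subr_wz mulrBr mulrBl mul1r mulr1 mulrA. Qed.

Lemma w_yexp n : w * y ^+ n = Q ^+ n *: (y ^+ n * w).
Proof.
elim: n => [|n IHn]; first by rewrite !expr0 scale1r mulr1 mul1r.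
by rewrite [y ^+ _]exprSr mulrA IHn -scalerAl -!mulrA wy_eq -scalerAr scalerA -exprSr.
Qed.

(** Moving z across a polynomial in y rescales y, so that z^i w^i reduces
    to a product of i factors that are polynomials in y. *)
Lemma zw_exp_gen i : subalg_gen y (z ^+ i * w ^+ i).
Proof.
have zgen f : subalg_gen y f -> exists2 f', subalg_gen y f' & z * f = f' * z.
  elim=> {f} [||f g _ [f' f'y ef] _ [g' g'y eg]|f g _ [f' f'y ef] _ [g' g'y eg]
         |a f _ [f' f'y ef]].
  - exists (Q^-1 *: y); first exact/sg_scale/sg_gen.
    by rewrite -scalerAl -zy_eq scalerA mulVf ?scale1r // Q_neq0.
  - by exists 1; [apply: sg_one | rewrite mulr1 mul1r].
  - by exists (f' + g'); [apply: sg_add | rewrite mulrDl mulrDr ef eg].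
  - exists (f' * g'); first exact: sg_mul.
    by rewrite mulrA ef -!mulrA eg.
  - by exists (a *: f'); [apply: sg_scale | rewrite -scalerAl -scalerAr ef].
have zw : subalg_gen y (z * w).
  have : subalg_gen y (1 + (-1) *: y).
    by apply: sg_add; [apply: sg_one | apply: sg_scale; apply: sg_gen].
  by rewrite scaleN1r subKr.
elim: i => [|i IHi]; first by rewrite !expr0 mulr1; apply: sg_one.
rewrite exprS exprSr mulrA -[z * z ^+ i * _]mulrA.
have [f' f'y ->] := zgen _ IHi.
by rewrite -mulrA; apply: sg_mul.
Qed.

Lemma subalg_gen_poly f : subalg_gen y f -> exists a : {poly C}, f = horner_alg y a.
Proof.
elim=> [||f1 f2 _ [a ->] _ [b ->]|f1 f2 _ [a ->] _ [b ->]|c f1 _ [a ->]].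
- by exists 'X; rewrite horner_algX.
- by exists 1; rewrite rmorph1.
- by exists (a + b); rewrite rmorphD.
- by exists (a * b); rewrite rmorphM.
- by exists (c *: a); rewrite linearZ /= mulr_algl.
Qed.

Definition wick_sum (s : seq (C * (nat * nat))) : Pol q :=
  \sum_(x <- s) x.1 *: (z ^+ x.2.1 * w ^+ x.2.2).

Definition is_wick (f : Pol q) := exists s, f = wick_sum s.

Lemma is_wickD f g : is_wick f -> is_wick g -> is_wick (f + g).
Proof. by move=> [s ->] [t ->]; exists (s ++ t); rewrite /wick_sum big_cat. Qed.

Lemma is_wick_sum I (r : seq I) (F : I -> Pol q) :
  (forall i, is_wick (F i)) -> is_wick (\sum_(i <- r) F i).
Proof.
move=> h; elim/big_rec: _ => [|i f _ wf]; last exact: is_wickD.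
by exists [::]; rewrite /wick_sum big_nil.
Qed.

Lemma is_wickZ c f : is_wick f -> is_wick (c *: f).
Proof.
move=> [s ->]; rewrite /wick_sum scaler_sumr; apply: is_wick_sum => x.
exists [:: (c * x.1, x.2)]; by rewrite /wick_sum big_seq1 /= scalerA.
Qed.

Lemma is_wick_mon i j : is_wick (z ^+ i * w ^+ j).
Proof. by exists [:: (1, (i, j))]; rewrite /wick_sum big_seq1 scale1r. Qed.

Lemma w_zexp i : w * z ^+ i.+1 = Q ^+ i.+1 *: (z ^+ i.+1 * w) + (1 - Q ^+ i.+1) *: z ^+ i.
Proof.
elim: i => [|i IHi]; first by rewrite expr1 expr0 wz_eq.
rewrite [z ^+ i.+2]exprSr mulrA IHi mulrDl -!scalerAl.
rewrite -(mulrA (z ^+ i.+1) w) wz_eq mulrDr -scalerAr mulr_algr.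
rewrite -(exprSr z i) -(mulrA (z ^+ i.+1) z) scalerDr !scalerA -addrA -scalerDl.
by congr (_ *: _ + _ *: _); rewrite [_ ^+ i.+2]exprSr //; ring.
Qed.

(** The span of the ordered monomials contains 1 and is stable under left
    multiplication by the generators. *)
Lemma all_wick f : is_wick f.
Proof.
suff mulwick a v : is_wick v -> is_wick (Defs.pi (p := Pol_pres q) a * v).
  elim/pres_ind: f => a; rewrite -[Defs.pi _]mulr1; apply: mulwick.
  by have := is_wick_mon 0 0; rewrite mulr1.
elim: a v => [[]|c|a iha b ihb|a iha b ihb] v.
- move=> [s ->]; rewrite mulr_sumr; apply: is_wick_sum => x.
  by rewrite -scalerAr mulrA -exprS; apply: is_wickZ; apply: is_wick_mon.
- move=> [s ->]; rewrite mulr_sumr; apply: is_wick_sum => -[c [[|i] j]] /=.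
    by rewrite -scalerAr mul1r -exprS -[w ^+ _]mul1r;
      apply: is_wickZ; apply: (is_wick_mon 0).
  rewrite -scalerAr mulrA w_zexp mulrDl -!scalerAl -mulrA -exprS.
  apply: is_wickZ; apply: is_wickD; apply: is_wickZ; exact: is_wick_mon.
- by rewrite pi_scal mulr_algl; apply: is_wickZ.
- by move=> wv; rewrite piD mulrDl; apply: is_wickD; [apply: iha|apply: ihb].
- by move=> wv; rewrite piM -mulrA; apply/iha/ihb.
Qed.
End QuantumDisc.

(** * The action on Pol(C)_q *)

(** The proof [hact] is an argument so that linearity can be recorded as an
    instance. *)
Definition Uact (R : realType) (q : R) (act : Uq q -> Pol q -> Pol q)
    (hact : is_Pol_action act) (u : aterm R[i] Ugen) (f : Pol q) : Pol q :=
  act (Upi q u) f.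

Section PolAction.
Variables (R : realType) (q : R).
Hypothesis hq : 0 < q < 1.
Variables (act : Uq q -> Pol q -> Pol q) (hact : is_Pol_action act).
Local Open Scope complex_scope.
Local Notation C := R[i].
Local Notation Q := (q%:C ^+ 2).
Local Notation s := ((Num.sqrt q)%:C).
Local Notation z := (Pz q).
Local Notation w := (Pzs q).
Local Notation y := (1 - z * w).
Local Notation Uact := (Uact hact).
Local Notation K := (@TGen C Ugen gK).
Local Notation Ki := (@TGen C Ugen gKi).
Local Notation E := (@TGen C Ugen gE).
Local Notation F := (@TGen C Ugen gF).

Lemma s_neq0 : s != 0 :> C.
Proof. by rewrite lt0r_neq0 // ltcR sqrtr_gt0; case/andP: hq. Qed.

Lemma Uact_is_linear u : linear (Uact u).
Proof. by have [[[h _ _ _] _ _] _ _ _ _] := hact; apply: h. Qed.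
HB.instance Definition _ u :=
  GRing.isLinear.Build C (Pol q) (Pol q) *:%R (Uact u) (Uact_is_linear u).

Lemma Uact_mul u u' f : Uact (u * u')%W f = Uact u (Uact u' f).
Proof.
by have [[[_ _ _ h] _ _] _ _ _ _] := hact; rewrite /Uact /Upi piM h.
Qed.

Lemma Uact_eq u u' f : pres_eq (@Uq_rel R q) u u' -> Uact u f = Uact u' f.
Proof. by move=> uu'; congr (act _ f); apply/Defs.piP. Qed.

Lemma Uact_scal c u f : Uact (TScal c * u)%W f = c *: Uact u f.
Proof.
have [[[_ h h1 _] _ _] _ _ _ _] := hact; rewrite Uact_mul /Uact /Upi pi_scal.
move: (act _ f) => g; have := h g 1 0 0; rewrite scaler0 addr0 scale1r => a0.
have {}a0 : act 0 g = 0 by apply: (addrI (act 0 g)); rewrite -a0 addr0.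
by have := h g c 1 0; rewrite addr0 h1 a0 addr0.
Qed.

Lemma Uact_one f : Uact 1%W f = f.
Proof. by have [[[_ _ h _] _ _] _ _ _ _] := hact; apply: h. Qed.

Lemma Uact_unit u : Uact u 1 = Ucounit u *: 1.
Proof. by have [[_ _ h] _ _ _ _] := hact; apply: h. Qed.

Lemma UactK_mul f g : Uact K (f * g) = Uact K f * Uact K g.
Proof.
by have [[_ h _] _ _ _ _] := hact; rewrite /Uact h big_seq1.
Qed.

Lemma UactKi_mul f g : Uact Ki (f * g) = Uact Ki f * Uact Ki g.
Proof.
by have [[_ h _] _ _ _ _] := hact; rewrite /Uact h big_seq1.
Qed.

Lemma UactF_mul f g : Uact F (f * g) = Uact F f * Uact Ki g + f * Uact F g.
Proof.
have [[_ h _] _ _ _ _] := hact; rewrite /Uact h big_cons big_seq1 /=.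
by rewrite -/(Uact 1%W f) Uact_one.
Qed.

Lemma UactK_z : Uact K z = Q *: z.
Proof. by have [_ _ []] := hact. Qed.
Lemma UactKi_z : Uact Ki z = Q^-1 *: z.
Proof. by have [_ _ []] := hact. Qed.
Lemma UactF_z : Uact F z = s *: 1.
Proof. by case: hact. Qed.

Lemma PstarM (f g : Pol q) : Pstar (f * g) = Pstar g * Pstar f.
Proof.
elim/pres_ind: f => a; elim/pres_ind: g => b.
by rewrite -piM !PstarE -piM.
Qed.

Lemma PstarZ c (f : Pol q) : Pstar (c *: f) = conjc c *: Pstar f.
Proof.
elim/pres_ind: f => a; rewrite -mulr_algl -pi_scal -piM !PstarE.
rewrite -[tstar _ _]/(tstar (@conjc R) a * TScal (conjc c))%W.
by rewrite piM pi_scal mulr_algr.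
Qed.

Lemma Pstar_z : Pstar z = w.
Proof. by rewrite PstarE. Qed.

Lemma UactKi_w : Uact Ki w = Q *: w.
Proof.
have [_ h [hK _] _ _] := hact; have := h K z.
by rewrite hK PstarZ conjQ Pstar_z => ->.
Qed.

Lemma UactK_w : Uact K w = Q^-1 *: w.
Proof.
have : Uact K (Uact Ki w) = w.
  by rewrite -Uact_mul -[RHS]Uact_one; apply: Uact_eq; apply/pe_rel/U_KKi.
rewrite UactKi_w linearZ /= => /(congr1 (fun f => Q^-1 *: f)).
by rewrite scalerA mulVf ?scale1r // Q_neq0.
Qed.

(** The action on w comes from that on z through (u f)* = S(u)* f*; for u = E,
    S(E)* = K F K^-1. *)
Lemma UactF_w : Uact F w = - (s * Q) *: (w * w).
Proof.
have : Uact (Ustar (Uantipode E)) w = - s *: (w * w).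
  have [_ h _ hE _] := hact; rewrite /Uact -Pstar_z -h hE PstarZ expr2 PstarM.
  by rewrite Pstar_z rmorphN; congr (- _ *: _); apply: conjc_real.
have scalr u c f : Uact (u * TScal c)%W f = c *: Uact u f.
  by rewrite -Uact_scal; apply/Uact_eq/pe_sym/pe_scalC.
rewrite -[Ustar _]/(TScal (-1) * (K * F) * Ki * TScal (conjc (-1)))%W.
rewrite scalr rmorphN1 Uact_mul Uact_scal Uact_mul UactKi_w !linearZ /= !scalerA.
rewrite mulN1r mulrN1 opprK.
rewrite -[Uact K _]Uact_mul (Uact_eq w (pe_rel (U_KF q))).
rewrite Uact_scal Uact_mul UactK_w scalerA mulfV ?Q_neq0 // scale1r.
rewrite linearZ /=.
move=> e; rewrite -[LHS]scale1r -(mulfV (Q_neq0 hq)) -scalerA e scalerA.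
by rewrite mulrN mulrC.
Qed.

Lemma UactK_wick i j : Uact K (z ^+ i * w ^+ j) = (Q ^+ i / Q ^+ j) *: (z ^+ i * w ^+ j).
Proof.
have exp_act c x n : Uact K x = c *: x -> Uact K (x ^+ n) = c ^+ n *: x ^+ n.
  move=> cx; elim: n => [|n IHn]; first by rewrite !expr0 Uact_unit.
  by rewrite !exprS UactK_mul cx IHn -scalerAl -scalerAr scalerA.
rewrite UactK_mul (exp_act _ _ _ UactK_z) (exp_act _ _ _ UactK_w).
by rewrite -scalerAl -scalerAr scalerA exprVn.
Qed.

(** If a is a polynomial with a(1) = 1, then a(K) fixes p; choosing a to vanish
    at the weights other than 1 removes every monomial z^i w^j with i <> j. *)
Lemma weight0_gen p : Uact K p = p -> subalg_gen y p.
Proof.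
have [sq ->] := all_wick p; set f := wick_sum q sq => Kf.
pose wt (x : C * (nat * nat)) := Q ^+ x.2.1 / Q ^+ x.2.2.
(* Both sides are a(K) applied to f. *)
have evalf (a : {poly C}) : a.[1] *: f =
    \sum_(x <- sq) (x.1 * a.[wt x]) *: (z ^+ x.2.1 * w ^+ x.2.2).
  elim/poly_ind: a => [|a c IHa].
    by rewrite horner0 scale0r big1 // => x _; rewrite horner0 mulr0 scale0r.
  rewrite hornerMXaddC mulr1 scalerDl -{1}Kf -linearZ IHa linear_sum scaler_sumr.
  rewrite -big_split; apply: eq_bigr => x _ /=.
  rewrite linearZ /= UactK_wick !scalerA -scalerDl hornerMXaddC; congr (_ *: _).
  by rewrite /wt; ring.
pose a : {poly C} := \prod_(x <- sq | wt x != 1) ('X - (wt x)%:P).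
have a1 : a.[1] != 0.
  rewrite horner_prod prodf_seq_neq0; apply/allP => x _; apply/implyP => wx.
  by rewrite hornerXsubC subr_eq0 eq_sym.
rewrite -[f]scale1r -(mulVf a1) -scalerA evalf; apply: sg_scale.
rewrite big_seq; elim/big_rec: _ => [|x f' xs IH].
  by rewrite -(scale0r 1); apply/sg_scale/sg_one.
apply: sg_add IH.
have [wx|wx] := eqVneq (wt x) 1; last first.
  have -> : a.[wt x] = 0.
    rewrite horner_prod; apply/eqP; rewrite prodf_seq_eq0; apply/hasP.
    by exists x => //; rewrite wx hornerXsubC subrr eqxx.
  by rewrite mulr0 scale0r -(scale0r 1); apply/sg_scale/sg_one.
have <- : x.2.1 = x.2.2.
  apply: (Q_exp_inj hq); apply: (mulIf (invr_neq0 (expf_neq0 x.2.2 (Q_neq0 hq)))).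
  by rewrite -/(wt x) wx divff // expf_neq0 // Q_neq0.
by apply/sg_scale/zw_exp_gen.
Qed.

(** On y^n the two sides of (E) differ by a multiple of (q^(2n) - q^4) y^n w,
    so that every coefficient except that of y^2 vanishes. In deformation terms,
    p is the value at (w, z) of an invariant Hochschild 2-cocycle, and there is
    one such cocycle up to scalars. *)
Lemma cocycle_classification p :
    Uact K p = p -> Uact F p = - s *: (w * p + Q *: (p * w)) ->
  exists c, p = c *: y ^+ 2.
Proof.
move=> /weight0_gen/subalg_gen_poly[a pE] Fp.
have {}pE : p = \sum_(i < size a) a`_i *: y ^+ i.
  rewrite pE -{1}[a]coefK poly_def linear_sum; apply: eq_bigr => i _.
  by rewrite linearZ /= rmorphXn /= horner_algX mulr_algl.
pose b i := a`_i * (s * (Q ^+ i - Q ^+ 2)).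
have b0 : \sum_(i < size a) b i *: (y ^+ i * w) = 0.
  have : (1 - Q) *: (Uact F p + s *: (w * p + Q *: (p * w))) = 0.
    by rewrite Fp scaleNr addNr scaler0.
  apply: etrans; rewrite pE mulr_sumr mulr_suml linear_sum !scaler_sumr.
  rewrite -big_split scaler_sumr -big_split scaler_sumr; apply: eq_bigr => i _ /=.
  rewrite linearZ /= -scalerAr w_yexp -scalerAl !scalerDr.
  rewrite [_ *: (_ *: Uact F _)]scalerA [(1 - Q) * _]mulrC.
  have -> : (a`_i * (1 - Q)) *: Uact F (y ^+ i) =
      a`_i *: (- (s * Q * (1 - Q ^+ i)) *: (y ^+ i * w)).
    rewrite -scalerA; congr (_ *: _); apply: (@disc_D_exp _ _ (Uact F) (Uact Ki) s Q Q^-1 z w).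
    - by rewrite mulfV // Q_neq0.
    - exact: UactF_mul.
    - exact: UactKi_mul.
    - exact: etrans (Uact_unit F) (scale0r _).
    - exact: etrans (Uact_unit Ki) (scale1r _).
    - exact: UactF_z.
    - exact: UactF_w.
    - exact: UactKi_z.
    - exact: UactKi_w.
    - exact: w_yexp.
  by rewrite !scalerA -!scalerDl; congr (_ *: _); rewrite /b; ring.
have {b0}a0 i : (i < size a)%N -> i != 2 -> a`_i = 0.
  move=> ia i2; apply/eqP; have /eqP := yw_free hq b0 ia.
  rewrite /b !mulf_eq0 subr_eq0 (inj_eq (Q_exp_inj hq)) (negPf i2) orbF.
  by rewrite (negPf s_neq0) orbF.
exists a`_2; rewrite {}pE; have [a2|a2] := ltnP 2 (size a).
  by rewrite (bigD1 (Ordinal a2)) //= big1 ?addr0 // => i i2; rewrite a0 ?scale0r.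
rewrite big1 => [|i _]; first by rewrite nth_default ?scale0r.
by rewrite a0 ?scale0r // neq_ltn (leq_trans _ a2).
Qed.

End PolAction.

(** * The deformed algebra *)

(** The hypotheses on the product are arguments so that the ring structure can
    be inferred from the type. *)
Definition starAlg (R : realType) (q : R) (star : tser (Pol q) -> tser (Pol q) -> tser (Pol q))
  (hdef : is_deformation star) (hsep : separates_variables star) : Type := tser (Pol q).

Section StarAlgebra.
Variables (R : realType) (q : R).
Variable star : tser (Pol q) -> tser (Pol q) -> tser (Pol q).
Hypotheses (hdef : is_deformation star) (hsep : separates_variables star).
Local Open Scope complex_scope.
Local Notation C := R[i].
Local Notation PolT := (tser (Pol q)).
Implicit Types (F G H : PolT).

Lemma starDl F F' G : star (F + F') G = star F G + star F' G.
Proof.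
by have [_ h _ _ _] := hdef; have := h 1 F F' G; rewrite !tscale1.
Qed.

Lemma starDr F G G' : star F (G + G') = star F G + star F G'.
Proof.
by have [_ _ h _ _] := hdef; have := h 1 F G G'; rewrite !tscale1.
Qed.

Lemma starZl c F G : star (tscale c F) G = tscale c (star F G).
Proof.
have [_ h _ _ _] := hdef; have := h c F 0 G; rewrite addr0 => ->.
have -> : star 0 G = 0; last by rewrite addr0.
by apply: (addrI (star 0 G)); rewrite -starDl !addr0.
Qed.

Lemma starZr c F G : star F (tscale c G) = tscale c (star F G).
Proof.
have [_ _ h _ _] := hdef; have := h c F G 0; rewrite addr0 => ->.
have -> : star F 0 = 0; last by rewrite addr0.
by apply: (addrI (star F 0)); rewrite -starDr !addr0.
Qed.

Lemma tcoef_star0 F G : tcoef (star F G) 0 = tcoef F 0 * tcoef G 0.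
Proof.
rewrite (tser_split F) (tser_split G) starDl starZl tcoefD tcoef_tvar0 addr0.
rewrite starDr starZr !tcoefD !tcoef_tvar0 !addr0.
by have [_ _ _ _ ->] := hdef.
Qed.

Lemma star1F F : star (tconst 1) F = F.
Proof.
apply: tserP => n; elim: n F => [|n IHn] F; first by rewrite tcoef_star0 mul1r.
rewrite [in LHS](tser_split F) starDr starZr tcoefD tcoef_tvarS IHn.
by rewrite hsep ?mul1r ?add0r //; left; apply: sg_one.
Qed.

Lemma starF1 F : star F (tconst 1) = F.
Proof.
apply: tserP => n; elim: n F => [|n IHn] F; first by rewrite tcoef_star0 mulr1.
rewrite [in LHS](tser_split F) starDl starZl tcoefD tcoef_tvarS IHn.
by rewrite hsep ?mulr1 ?add0r //; right; apply: sg_one.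
Qed.

Lemma tscale_star c F : tscale c F = star (tscale c (tconst 1)) F.
Proof. by rewrite starZl star1F. Qed.

(** Scaling by c is multiplication by c 1, so that this follows from the
    associativity of the product. *)
Lemma tscaleA c d F : tscale c (tscale d F) = tscale (c * d) F.
Proof.
have [starA _ _ _ _] := hdef.
rewrite (tscale_star d) (tscale_star c) starA -tscale_star [RHS]tscale_star.
congr (star _ F).
have unitE e n : tcoef (tscale e (tconst (1 : Pol q))) n = tcoef e n *: 1.
  rewrite /= big_ord_recr big1 /= ?subnn ?add0r // => i _.
  have : (0 < n - i)%N by rewrite subn_gt0.
  by case: (n - i)%N => // m _; rewrite scaler0.
apply: tserP => n; rewrite unitE scaler_suml; apply: eq_bigr => i _.
by rewrite unitE scalerA.
Qed.

Local Notation A := (starAlg hdef hsep).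
HB.instance Definition _ := GRing.Zmodule.copy A PolT.

Lemma starA : associative (star : A -> A -> A). Proof. by have [] := hdef. Qed.
Lemma star_one_neq0 : (tconst 1 : A) != 0.
Proof. by apply/eqP => /(congr1 (fun F : PolT => tcoef F 0)) /eqP; rewrite oner_eq0. Qed.

HB.instance Definition _ := GRing.Zmodule_isNzRing.Build A
  starA star1F starF1 starDl starDr star_one_neq0.
HB.instance Definition _ := GRing.Zmodule_isLmodule.Build (tser C) A
  tscaleA (@tscale1 C (Pol q)) (@tscaleDr C (Pol q))
  (fun F c d => tscaleDl c d F).
Lemma starZAl (c : tser C) (F G : A) : c *: (F * G) = c *: F * G.
Proof. by rewrite -[RHS]/(star (tscale c F) G) starZl. Qed.
HB.instance Definition _ := GRing.Lmodule_isLalgebra.Build (tser C) A starZAl.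
Lemma starZAr (c : tser C) (F G : A) : c *: (F * G) = F * (c *: G).
Proof. by rewrite -[RHS]/(star F (tscale c G)) starZr. Qed.
HB.instance Definition _ := GRing.Lalgebra_isAlgebra.Build (tser C) A starZAr.

Definition cst (f : Pol q) : A := tconst f.

Lemma cstM f g : subalg_gen (Pz q) f \/ subalg_gen (Pzs q) g ->
  cst f * cst g = cst (f * g).
Proof. exact: hsep. Qed.

Lemma cstZ a f : cst (a *: f) = tconst a *: cst f.
Proof.
rewrite -[RHS]/(tscale _ (tconst f)) tscale_const.
by apply: tserP => -[|n] //=; rewrite scaler0.
Qed.

Lemma tcoefZvar0 (x : A) : tcoef (tvar C *: x) 0 = 0.
Proof. exact: tcoef_tvar0. Qed.
Lemma tcoefZvarS (x : A) n : tcoef (tvar C *: x) n.+1 = tcoef x n.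
Proof. exact: tcoef_tvarS. Qed.

Lemma tvar_inj : injective (fun x : A => tvar C *: x).
Proof.
move=> x x' e; apply: tserP => n.
by rewrite -tcoefZvarS e tcoefZvarS.
Qed.

(** Iterating the equation puts x in every t^n A. *)
Lemma eq0_contract psi (x u : A) : tcoef psi 0 = 0 -> x = psi *: (x * u) -> x = 0.
Proof.
move=> psi0 xE; have iterE n : x = psi ^+ n *: (x * u ^+ n).
  elim: n => [|n IHn]; first by rewrite !expr0 mulr1 scale1r.
  by rewrite {1}IHn {1}xE -scalerAl scalerA -exprSr -mulrA -exprS.
apply: tserP => n; rewrite (iterE n.+1).
have := @tscale_teqmod0 C (Pol q) n.+1 0 _ (x * u ^+ n.+1) (teqmod_exp psi0).
by rewrite addn0 => h; apply: h.
Qed.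
End StarAlgebra.

(** * Invariant solutions and the commutation relation *)

Definition Sact (R : realType) (q : R) (act : Uq q -> Pol q -> Pol q)
    (hact : is_Pol_action act) (star : tser (Pol q) -> tser (Pol q) -> tser (Pol q))
    (hdef : is_deformation star) (hsep : separates_variables star)
    (u : aterm R[i] Ugen) : starAlg hdef hsep -> starAlg hdef hsep :=
  tmap (Uact hact u).

Section CovariantStar.
Variables (R : realType) (q : R).
Hypothesis hq : 0 < q < 1.
Variables (act : Uq q -> Pol q -> Pol q) (hact : is_Pol_action act).
Variable star : tser (Pol q) -> tser (Pol q) -> tser (Pol q).
Hypotheses (hdef : is_deformation star) (hsep : separates_variables star).
Hypothesis hcov : is_covariant act star.
Local Open Scope complex_scope.
Local Notation C := R[i].
Local Notation Q := (q%:C ^+ 2).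
Local Notation s := ((Num.sqrt q)%:C).
Local Notation A := (starAlg hdef hsep).
Local Notation Sact := (@Sact R q act hact star hdef hsep).
Local Notation cst := (@cst R q star hdef hsep).
Local Notation K := (@TGen C Ugen gK).
Local Notation Ki := (@TGen C Ugen gKi).
Local Notation F := (@TGen C Ugen gF).
Local Notation t := (tvar C).
Local Notation z := (cst (Pz q)).
Local Notation w := (cst (Pzs q)).
Local Notation y := (1 - z * w).
Local Notation y' := (1 - w * z).

Lemma Sact_is_linear u : linear (Sact u).
Proof.
move=> c x x'; rewrite -[RHS]/(tscale c _ + _) -tscale_map.
by apply: tserP => n; rewrite /= linearD.
Qed.
HB.instance Definition _ u :=
  GRing.isLinear.Build (tser C) A A *:%R (Sact u) (Sact_is_linear u).

Lemma Sact_cst u f : Sact u (cst f) = cst (Uact hact u f).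
Proof. by apply: tserP => -[|n] //=; rewrite linear0. Qed.

Lemma SactK_mul x x' : Sact K (x * x') = Sact K x * Sact K x'.
Proof. by have [_ h _] := hcov; rewrite [LHS]h big_seq1. Qed.

Lemma SactKi_mul x x' : Sact Ki (x * x') = Sact Ki x * Sact Ki x'.
Proof. by have [_ h _] := hcov; rewrite [LHS]h big_seq1. Qed.

Lemma SactF_mul x x' : Sact F (x * x') = Sact F x * Sact Ki x' + x * Sact F x'.
Proof.
have [_ h _] := hcov; rewrite [LHS]h big_cons big_seq1; congr (_ + star _ _).
by apply: tserP => n; apply: (Uact_one hact).
Qed.

Lemma Sact_unit u : Sact u 1 = tconst (Ucounit u) *: 1.
Proof. by rewrite -[1]/(cst 1) Sact_cst Uact_unit cstZ. Qed.

Lemma SactF_w : Sact F w = - (tconst s * tconst Q) *: (w * w).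
Proof.
rewrite Sact_cst (UactF_w hq) cstZ rmorphN rmorphM cstM //.
by right; apply: sg_gen.
Qed.

Lemma SactF_z : Sact F z = tconst s *: 1.
Proof. by rewrite Sact_cst UactF_z cstZ. Qed.

Lemma SactKi_z : Sact Ki z = tconst Q^-1 *: z.
Proof. by rewrite Sact_cst UactKi_z cstZ. Qed.

Lemma SactKi_w : Sact Ki w = tconst Q *: w.
Proof. by rewrite Sact_cst UactKi_w cstZ. Qed.

Lemma SactK_z : Sact K z = tconst Q *: z.
Proof. by rewrite Sact_cst UactK_z cstZ. Qed.

Lemma SactK_w : Sact K w = tconst Q^-1 *: w.
Proof. by rewrite Sact_cst (UactK_w hq) cstZ. Qed.

Lemma tconst_QQi : tconst Q * tconst Q^-1 = 1 :> tser C.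
Proof. by rewrite -rmorphM mulfV // Q_neq0. Qed.

Lemma tconst_QiQ : tconst Q^-1 * tconst Q = 1 :> tser C.
Proof. by rewrite mulrC tconst_QQi. Qed.

Lemma SactF1 : Sact F 1 = 0.
Proof. by rewrite Sact_unit rmorph0 scale0r. Qed.

Lemma SactKi1 : Sact Ki 1 = 1.
Proof. by rewrite Sact_unit rmorph1 scale1r. Qed.

Lemma SactK1 : Sact K 1 = 1.
Proof. by rewrite Sact_unit rmorph1 scale1r. Qed.

(** The equation (E). *)
Definition invariant_solution (x : A) :=
  Sact K x = x /\ disc_solution (Sact F) (tconst s) (tconst Q) w x.

Lemma invariant_solution_lin c x x' :
  invariant_solution x -> invariant_solution x' -> invariant_solution (c *: x + x').
Proof.
move=> [Kx Fx] [Kx' Fx']; split; last exact: disc_solution_lin.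
by rewrite linearP /= Kx Kx'.
Qed.

Lemma Ky : Sact K y = y.
Proof. exact: (disc_L_y tconst_QiQ SactK_mul SactK1 SactK_z SactK_w). Qed.

Lemma Ky' : Sact K y' = y'.
Proof. exact: (disc_L_y' tconst_QiQ SactK_mul SactK1 SactK_z SactK_w). Qed.

Lemma invariant_solution_yy : invariant_solution (y' * y).
Proof.
split; first by rewrite SactK_mul Ky Ky'.
exact: (disc_solution_yy tconst_QQi SactF_mul SactKi_mul SactF1 SactKi1
  SactF_z SactF_w SactKi_z SactKi_w).
Qed.

Lemma invariant_solution_diff : invariant_solution (y' - tconst Q *: y).
Proof.
split; first by rewrite linearB linearZ /= Ky Ky'.
exact: (disc_solution_diff tconst_QQi SactF_mul SactF1
  SactF_z SactF_w SactKi_z SactKi_w).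
Qed.

Lemma tcoefDA (x x' : A) n : tcoef (x + x') n = tcoef x n + tcoef x' n.
Proof. by []. Qed.

Lemma tcoefZ0 c (x : A) : tcoef (c *: x) 0 = tcoef c 0 *: tcoef x 0.
Proof. exact: tcoef_tscale0. Qed.

Lemma tcoef_starM (x x' : A) : tcoef (x * x') 0 = tcoef x 0 * tcoef x' 0.
Proof. exact: tcoef_star0. Qed.

Lemma tcoef_y0 : tcoef y 0 = 1 - Pz q * Pzs q.
Proof. by rewrite [LHS]/(1 - tcoef (z * w) 0) tcoef_starM. Qed.

Lemma tcoef_y'0 : tcoef y' 0 = Q *: (1 - Pz q * Pzs q).
Proof. by rewrite -subr_wz -[LHS]/(1 - tcoef (w * z) 0) tcoef_starM. Qed.

Lemma invariant_solution_shift (x : A) : invariant_solution (t *: x) -> invariant_solution x.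
Proof.
move=> [Kx Fx]; split; apply: (@tvar_inj _ _ _ hdef hsep); first by rewrite -linearZ.
rewrite -linearZ [LHS]Fx scalerA mulrC -scalerA; congr (_ *: _).
rewrite -scalerAr -scalerAl scalerDr; congr (_ + _).
by rewrite !scalerA mulrC.
Qed.

(** The constant term of x is a multiple of that of y' y; subtracting the
    multiple leaves a solution divisible by t, and the quotient is again a
    solution. *)
Lemma invariant_solution_step (x : A) : invariant_solution x ->
  exists a (x' : A), x = tconst a *: (y' * y) + t *: x' /\ invariant_solution x'.
Proof.
move=> solx; have [Kx Fx] := solx.
have [b x0] : exists b, tcoef x 0 = b *: (1 - Pz q * Pzs q) ^+ 2.
  apply: (cocycle_classification hq (hact := hact)).
    by have /(congr1 (fun f : tser (Pol q) => tcoef f 0)) := Kx.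
  have /(congr1 (fun f : tser (Pol q) => tcoef f 0)) := Fx.
  move=> e; rewrite -[LHS]/(tcoef (Sact F x) 0) [LHS]e.
  by rewrite tcoefZ0 (tcoefD (w * x)) tcoefZ0 !tcoef_starM.
pose x1 := x - tconst (b / Q) *: (y' * y).
have x1E : x1 = t *: (tshift x1 : A).
  rewrite [LHS](tser_split (x1 : tser (Pol q))).
  rewrite [tcoef x1 0](_ : _ = 0) ?tconst0 ?add0r //.
  rewrite -[LHS]/(tcoef x 0 - tcoef (tconst (b / Q) *: (y' * y)) 0).
  rewrite tcoefZ0 tcoef_starM tcoef_y'0 tcoef_y0 x0 -scalerAl scalerA.
  by rewrite divfK ?Q_neq0 // expr2 subrr.
exists (b / Q), (tshift x1 : A); split; first by rewrite -x1E addrC subrK.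
apply: invariant_solution_shift; rewrite -x1E /x1 addrC -scaleNr.
exact: (invariant_solution_lin _ invariant_solution_yy solx).
Qed.

(** Repeating the step gives the coefficients of psi one at a time. *)
Lemma invariant_solution_span (x : A) : invariant_solution x ->
  exists psi : tser C, x = psi *: (y' * y).
Proof.
pose P (x : A) (p : C * A) := invariant_solution x ->
  x = tconst p.1 *: (y' * y) + t *: p.2 /\ invariant_solution p.2.
have /choice[step stepP] : forall x, exists p, P x p.
  move=> {}x; have [solx|nsolx] := pselect (invariant_solution x); last by exists (0, 0).
  by have [a [x' ?]] := invariant_solution_step solx; exists (a, x').
pose psi x : tser C := TSer (fun n => (step (iter n (snd \o step) x)).1).
have psiE x0 : psi x0 = tconst (step x0).1 + t * psi (step x0).2.
  rewrite [LHS](@tser_split C C^o) tmulE; congr (_ + tscale _ _).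
  by apply: tserP => n; rewrite /= -iterSr.
exists (psi x); apply: tserP => n.
elim: n x H => [|n IHn] x solx; have [xE solx'] := stepP x solx.
all: rewrite {1}xE psiE scalerDl -scalerA.
  by rewrite !tcoefDA !tcoefZvar0.
by rewrite !tcoefDA !tcoefZvarS IHn.
Qed.

(** The relation (R). The commutator d = [y', y] satisfies d = psi d y by (R), so
    that it vanishes. *)
Lemma star_relation : exists psi : tser C, [/\ tcoef psi 0 = 0,
  y' = tconst Q *: y + psi *: (y' * y) & y' * y = y * y'].
Proof.
have [psi psiE] := invariant_solution_span invariant_solution_diff.
have y'E : y' = tconst Q *: y + psi *: (y' * y) by rewrite -psiE [RHS]addrC subrK.
have psi0 : tcoef psi 0 = 0.
  have /(congr1 (fun f : tser (Pol q) => tcoef f 0)) := psiE.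
  rewrite tcoefZ0 tcoef_starM -[LHS]/(tcoef y' 0 - tcoef (tconst Q *: y) 0).
  rewrite tcoefZ0 tcoef_y'0 tcoef_y0 subrr -scalerAl scalerA.
  (* y^2 <> 0, since it acts on the vacuum component by 1. *)
  move=> /(congr1 (fun f => fockP f (fun=> 1) 0%N)).
  rewrite fockPZ fockPM !fockP_y expr0 !mul1r mulr1 -(scale0r 0) fockPZ mul0r.
  by move=> /esym/eqP; rewrite mulf_eq0 (negPf (Q_neq0 hq)) orbF => /eqP.
exists psi; split => //; apply/eqP; rewrite -subr_eq0; apply/eqP.
apply: (eq0_contract psi0 (u := y)).
rewrite {1 2}y'E mulrDl (mulrDr y (_ *: y)) -!scalerAl -!scalerAr.
by rewrite opprD addrACA subrr add0r -scalerBr (mulrBl y (y' * y)) !mulrA.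
Qed.
End CovariantStar.

(** * Comparison with the Berezin algebra *)

(** The universal property, for morphisms that are semilinear along s: rho
    below changes the formal variable. *)
Section PresentedLift.
Variables (k : comNzRingType) (p : presentation k) (A : pzRingType).
Variables (s : {rmorphism k -> A}) (h : pgen p -> A).

Lemma presAlg_lift :
    (forall c a, s c * a = a * s c) ->
    (forall a b, prel a b -> teval s h a = teval s h b) ->
  exists rho : presAlg p -> A,
    [/\ forall a, rho (Defs.pi a) = teval s h a,
        {morph rho : x x' / x + x'}, {morph rho : x x' / x * x'} &
        forall c x, rho (c *: x) = s c * rho x].
Proof.
move=> sC hrel; exists (fun x => teval s h (repr x)).
have rho_pi a : teval s h (repr (Defs.pi (p := p) a)) = teval s h a.
  exact: (teval_pres_eq sC hrel) (Defs.repr_pi a).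
split=> // [x x'|x x'|c x].
- by elim/pres_ind: x => a; elim/pres_ind: x' => b; rewrite -piD !rho_pi.
- by elim/pres_ind: x => a; elim/pres_ind: x' => b; rewrite -piM !rho_pi.
- by elim/pres_ind: x => a; rewrite -mulr_algl -pi_scal -piM !rho_pi.
Qed.
End PresentedLift.

(** The scalars of the target of rho, with t replaced by c(t). *)
Definition subst_alg (k : comNzRingType) (A : algType (tser k)) (c : tser k)
  (c0 : tcoef c 0 = 0) (f : tser k) : A := (tsubst c f)%:A.

Section SubstAlg.
Variables (k : comNzRingType) (A : algType (tser k)) (c : tser k).
Hypothesis c0 : tcoef c 0 = 0.

Lemma subst_alg_zmod_morphism : zmod_morphism (subst_alg A c0).
Proof. by move=> f g; rewrite /subst_alg tsubstB scalerBl. Qed.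

Lemma subst_alg_monoid_morphism : monoid_morphism (subst_alg A c0).
Proof.
split=> [|f g]; first by rewrite /subst_alg (tsubst_const c 1) scale1r.
by rewrite /subst_alg tsubstM // -scalerAl mul1r scalerA.
Qed.

HB.instance Definition _ := GRing.isZmodMorphism.Build (tser k) A
  (subst_alg A c0) subst_alg_zmod_morphism.
HB.instance Definition _ := GRing.isMonoidMorphism.Build (tser k) A
  (subst_alg A c0) subst_alg_monoid_morphism.
End SubstAlg.

Section Berezin.
Variables (R : realType) (q : R).
Hypothesis hq : 0 < q < 1.
Local Open Scope complex_scope.
Local Notation C := R[i].
Local Notation Q := (q%:C ^+ 2).

(** Solving (1 - q^2) c / (1 - q^2 c) = phi for c; the denominator is invertible
    because q^2 <> 1. *)
Lemma berezin_reparam (phi : tser C) : tcoef phi 0 = 0 ->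
  exists c : tser C, tcoef c 0 = 0 /\ tsubst c (BPol_coef q) = phi.
Proof.
move=> phi0; have [|v uv] := @tser_inv C (tconst (1 - Q) + tconst Q * phi).
  by rewrite tcoefD tcoef_constM phi0 mulr0 addr0 unitfE subr1Q_neq0.
pose c := phi * v; have c0 : tcoef c 0 = 0.
  by rewrite /= big_ord_recl big_ord0 phi0 mul0r addr0.
exists c; split=> //.
have phiE : phi = c * (tconst (1 - Q) + tconst Q * phi).
  by rewrite -mulrA [v * _]mulrC uv mulr1.
have cE : tconst (1 - Q) * c = phi * (1 - tconst Q * c).
  by rewrite mulrBr mulr1 {1}phiE; ring.
have := congr1 (tsubst c) (tgeomP (Q : C)).
rewrite tsubstM // tsubstB tsubstM // tsubst_tvar // !tsubst_const => geomE.
rewrite /BPol_coef !tsubstM // tsubst_tvar // tsubst_const cE -mulrA geomE.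
by rewrite mulr1.
Qed.

Lemma tconj_const (a : C) : tconj (tconst a) = tconst (conjc a).
Proof. by apply: tserP => -[|n]; rewrite //=; apply: (rmorph0 (@conjc R)). Qed.

Lemma tconj_BPol_coef : tconj (BPol_coef q) = BPol_coef q.
Proof.
rewrite /BPol_coef !rmorphM; congr (_ * _ * _); apply: tserP => n.
- by rewrite [LHS](congr1 (fun f : tser C => tcoef f n) (tconj_const _)) conj1Q.
- by case: n => [|[|n]]; [exact: (rmorph0 (@conjc R)) | exact: (rmorph1 (@conjc R))
    | exact: (rmorph0 (@conjc R))].
- by rewrite -[RHS]/(Q ^+ n) -[in RHS]conjQ; exact: (rmorphXn (@conjc R)).
Qed.

Variables (act : Uq q -> Pol q -> Pol q) (hact : is_Pol_action act).
Variable star : tser (Pol q) -> tser (Pol q) -> tser (Pol q).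
Hypotheses (hdef : is_deformation star) (hsep : separates_variables star).
Hypothesis hcov : is_covariant act star.
Local Notation A := (starAlg hdef hsep).
Local Notation cst := (@cst R q star hdef hsep).
Local Notation z := (cst (Pz q)).
Local Notation w := (cst (Pzs q)).
Local Notation y := (1 - z * w).
Local Notation y' := (1 - w * z).

Lemma cst_wick i j : cst (Pz q ^+ i * Pzs q ^+ j) = z ^+ i * w ^+ j.
Proof.
have genX (x : Pol q) n : subalg_gen x (x ^+ n).
  elim: n => [|n IHn]; first by rewrite expr0; apply: sg_one.
  by rewrite exprS; apply: sg_mul => //; apply: sg_gen.
rewrite -cstM; last by left; apply: genX.
congr (_ * _).
  elim: i => [//|i IHi]; rewrite !exprS -IHi cstM //; left; exact: sg_gen.
elim: j => [//|j IHj]; rewrite !exprSr -IHj cstM //; right; exact: sg_gen.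
Qed.

Definition star_gen (x : sgen) : A := if x is gz then z else w.

Lemma BPol_to_star : exists c : tser C, exists c0 : tcoef c 0 = 0,
  exists rho : BPol q -> A,
    [/\ [/\ rho 1 = 1, rho (Bz q) = z & rho (Bzs q) = w],
        {morph rho : x x' / x + x'}, {morph rho : x x' / x * x'} &
        forall f x, rho (f *: x) = tsubst c f *: rho x].
Proof.
have [psi [psi0 y'E yC]] := star_relation hq hact hdef hsep hcov.
have [|c [c0 cE]] := @berezin_reparam (- psi); first by rewrite tcoefN psi0 oppr0.
exists c, c0.
have wzE : w * z = tconst Q *: (z * w) + tconst (1 - Q) *: 1 - psi *: (y' * y).
  rewrite -[LHS](subKr 1) {1}y'E opprD addrA; congr (_ - _).
  by rewrite scalerBr opprB rmorphB rmorph1 scalerBl scale1r addrCA.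
pose s : {rmorphism tser C -> A} := subst_alg A c0.
have sE f : s f = (tsubst c f)%:A by [].
have [||rho [rhoE rhoD rhoM rhoZ]] := @presAlg_lift _ (BPol_pres q) A s star_gen.
- by move=> f x; rewrite sE mulr_algl mulr_algr.
- have sc a : s (tconst a) = (tconst a)%:A by rewrite sE tsubst_const.
  have sb : s (BPol_coef q) = - psi%:A by rewrite sE cE scaleNr.
  move=> _ _ [a b [-> ->]|a b [-> ->]].
    cbn [teval]; rewrite !sc sb !rmorphN1 !mulN1r.
by rewrite !mulNr !mulr_algl !scale1r; exact: wzE.
  (* The adjoint relation: the product y' y becomes y y'. *)
  rewrite -[tstar _ _ in RHS]/(TGen gz * TGen gzs * TScal (tconj (tconst Q))
    + TScal (tconj (tconst (1 - Q)))
    + (TScal (tconj 1%R) + TGen gz * TGen gzs * TScal (tconj (-1)%R))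
      * (TScal (tconj 1%R) + TGen gzs * TGen gz * TScal (tconj (-1)%R))
      * TScal (tconj (BPol_coef q)))%W.
  rewrite !tconj_const conjQ conj1Q tconj_BPol_coef rmorphN1 rmorph1.
  cbn [teval tstar tanti sgen_swap].
  rewrite !sc sb !rmorphN1 !mulrN1 mulrN !mulr_algr.
  by rewrite !scale1r -[(1 - z * w) * _]yC; exact: wzE.
exists rho; split=> // [|f x]; last by rewrite rhoZ sE mulr_algl.
by split; rewrite ?[rho 1](rhoE 1%W) ?rhoE //; apply: rmorph1.
Qed.
End Berezin.

Theorem theorem5p1 (R : realType) (q : R) (hq : 0 < q < 1)
    (act : Uq q -> Pol q -> Pol q) (hact : is_Pol_action act)
    (starB : tser (Pol q) -> tser (Pol q) -> tser (Pol q))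
    (hB : is_Berezin starB)
    (star : tser (Pol q) -> tser (Pol q) -> tser (Pol q))
    (hdef : is_deformation star)
    (hsep : separates_variables star)
    (hreal : is_real star)
    (hcov : is_covariant act star) :
  exists c : tser (complex R), tcoef c 0 = 0 /\
    forall f g : Pol q,
      tadic_limit
        (fun N => tconst (f * g) +
           \sum_(1 <= i < N) tscale (c ^+ i) (tconst (deform_coef starB i f g)))
        (star (tconst f) (tconst g)).
Proof.
have [c [c0 [rho [[rho1 rhoz rhozs] rhoD rhoM rhoZ]]]] :=
  BPol_to_star hq hact hdef hsep hcov.
have [I [[Ilin Imon] Istar]] := hB.
exists c; split=> // f g.
pose cst' : Pol q -> starAlg hdef hsep := @cst R q star hdef hsep.
have rho0 : rho 0 = 0 by apply: (addrI (rho 0)); rewrite -rhoD !addr0.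
have I0 : I 0 = 0.
  have := Ilin 1 0 0; rewrite scaler0 addr0 scale1r => e.
  by apply: (addrI (I 0)); rewrite addr0 -e.
have rhoX x n : rho (x ^+ n) = rho x ^+ n.
  by elim: n => [|n IHn]; rewrite ?expr0 // !exprS rhoM IHn.
have rhoI h : rho (I h) = cst' h.
  have [sq ->] := all_wick h; rewrite /wick_sum.
  elim: sq => [|x sq IHsq]; first by rewrite !big_nil I0 rho0 /cst' /cst tconst0.
  rewrite !big_cons Ilin rhoD IHsq rhoZ Imon rhoM !rhoX rhoz rhozs.
  by rewrite tsubst_const -cst_wick -cstZ; apply: esym; apply: tconstD.
have tvarX n : tsubst c (tvar _ ^+ n) = c ^+ n.
  elim: n => [|n IHn]; first by rewrite !expr0; apply: (tsubst_const c 1).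
  by rewrite !exprS tsubstM // IHn tsubst_tvar.
(* The image under rho of the congruence modulo t^(n+1) that defines starB. *)
have key n : exists r : starAlg hdef hsep,
    \sum_(i < n.+1) c ^+ i *: cst' (deform_coef starB i f g) - cst' f * cst' g =
    c ^+ n.+1 *: r.
  have [r rE] := Istar (tconst f) (tconst g) n.+1; exists (rho r).
  have Iconst h : Iinfty I n.+1 (tconst h) = I h.
    rewrite /Iinfty big_ord_recl expr0 scale1r big1 ?addr0 // => i _.
    by rewrite /= I0 scaler0.
  rewrite -tvarX -rhoZ -rE !Iconst.
  apply: (addIr (cst' f * cst' g)); rewrite subrK -!rhoI -rhoM -rhoD subrK.
  rewrite (@big_morph _ _ rho 0 +%R 0 +%R) //; apply: eq_bigr => i _.
  by rewrite rhoZ tvarX rhoI.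
(* The modulus c is divisible by t, so the constant terms agree. *)
have m0 : deform_coef starB 0 f g = f * g.
  have [r] := key 0; rewrite big_ord1 expr0 scale1r expr1.
  move=> /(congr1 (fun F : tser (Pol q) => tcoef F 0)).
  rewrite [RHS]tcoef_tscale0 c0 scale0r => /eqP.
  by rewrite [tcoef _ 0]/(_ - tcoef (star _ _) 0) tcoef_star0 // subr_eq0 => /eqP.
move=> n; exists n.+1 => -[//|N] ltnN k ltkn.
have [r rE0] := key N.
have -> : tconst (f * g) + \sum_(1 <= i < N.+1)
    tscale (c ^+ i) (tconst (deform_coef starB i f g)) =
    \sum_(i < N.+1) c ^+ i *: cst' (deform_coef starB i f g).
  rewrite -(big_mkord xpredT (fun i => c ^+ i *: cst' (deform_coef starB i f g))).
  by rewrite big_ltn // expr0 scale1r m0.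
have {}rE : tcoef (c ^+ N.+1 *: r) k = 0.
  have := @tscale_teqmod0 _ (Pol q) _ 0 _ r (teqmod_exp (n := N.+1) c0).
  by rewrite addn0; apply=> //; apply: leq_trans ltkn (ltnW ltnN).
by apply/eqP; rewrite -subr_eq0 -rE -rE0.
Qed.
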